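(* Let $K$ be an infinite commutative domain. There exists a function $f$ of two natural numbers $d,n$ such that whenever $R$ is an associative $K$-algebra on which $K$ acts torsion-freely, $R$ is generated as a $K$-algebra by $d$ elements, and $(R,\circ)$ satisfies a (nontrivial) semigroup identity of degree $n$, then $R$ is upper Lie nilpotent of index at most $f(d,n)$, i.e. $\gamma^{f(d,n)}(R)=0$.
   Context: $(R,\circ)$ is $R$ with the operation $x\circ y=x+y+xy$. A semigroup identity is $u=v$ with $u\ne v$ words in free variables, holding under all substitutions; its degree is the maximal length of $u$ and $v$. Define associative ideals $\gamma^1(R)=R$ and $\gamma^{i+1}(R)$ = the associative ideal of $R$ generated by all $[a,r]=ar-ra$ with $a\in\gamma^i(R)$, $r\in R$. $R$ is upper Lie nilpotent of index at most $N$ if $\gamma^N(R)=0$. The function $f$ does not depend on $R$, $K$ or the characteristic of $K$. *)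

(* Defs.v *)
(* Non-unital associative K-algebras are not in the library,
   so an algebra is given as a K-module R together with a multiplication. *)
From HB Require Import structures.
From mathcomp Require Import all_boot all_order all_algebra.
Set Implicit Arguments. Unset Strict Implicit. Unset Printing Implicit Defensive.
Import GRing.Theory.
Local Open Scope ring_scope.

Section Defs.
Variables (K : comNzRingType) (R : lmodType K) (mul : R -> R -> R).

Definition is_assoc_alg : Prop :=
  [/\ associative mul,
      (forall x y z, mul (x + y) z = mul x z + mul y z),
      (forall x y z, mul x (y + z) = mul x y + mul x z),
      (forall (a : K) x y, mul (a *: x) y = a *: mul x y) &
      (forall (a : K) x y, mul x (a *: y) = a *: mul x y)].

Definition torsion_free : Prop :=
  forall (a : K) (x : R), a *: x = 0 -> a = 0 \/ x = 0.

Definition is_subalg (P : R -> Prop) : Prop :=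
  [/\ P 0, (forall x y, P x -> P y -> P (x + y)),
      (forall (a : K) x, P x -> P (a *: x)) &
      (forall x y, P x -> P y -> P (mul x y))].

Definition generates (d : nat) (g : 'I_d -> R) : Prop :=
  forall P : R -> Prop, is_subalg P -> (forall i, P (g i)) -> forall x, P x.

Definition is_ideal (I : R -> Prop) : Prop :=
  [/\ I 0, (forall x y, I x -> I y -> I (x + y)),
      (forall (a : K) x, I x -> I (a *: x)) &
      (forall x r, I x -> I (mul x r) /\ I (mul r x))].

Definition ideal_gen (S : R -> Prop) (x : R) : Prop :=
  forall I : R -> Prop, is_ideal I -> (forall s, S s -> I s) -> I x.

Definition comm (a r : R) : R := mul a r - mul r a.

(* gam m = gamma^(m+1)(R) *)
Fixpoint gam (m : nat) : R -> Prop :=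
  match m with
  | 0 => fun _ => True
  | m'.+1 => ideal_gen (fun c => exists a r, gam m' a /\ c = comm a r)
  end.

(* gamma^i(R), i >= 1; by convention gamma^0(R) = R *)
Definition gamma (i : nat) : R -> Prop := gam i.-1.

Definition upper_Lie_nilpotent (N : nat) : Prop :=
  forall x, gamma N x -> x = 0.

Definition circ (x y : R) : R := x + y + mul x y.

End Defs.

(* semigroup words: nonempty sequences of variables (indexed by nat) *)
Definition word_eval (T : Type) (op : T -> T -> T) (s : nat -> T)
  (w : seq nat) : T :=
  foldl (fun acc v => op acc (s v)) (s (head 0%N w)) (behead w).

Definition sg_identity_holds (T : Type) (op : T -> T -> T) (u v : seq nat) : Prop :=
  forall s : nat -> T, word_eval op s u = word_eval op s v.

Definition has_sg_identity (T : Type) (op : T -> T -> T) (n : nat) : Prop :=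
  exists u v : seq nat,
    [/\ u != [::], v != [::], u != v, maxn (size u) (size v) = n
      & sg_identity_holds op u v].

Definition infinite_type (T : eqType) : Prop :=
  forall s : seq T, exists x : T, x \notin s.

(* Main.v *)
(* From the identity to an Engel condition.  In the unital hull K (+) R the
   identity reads u(1 + x) = w(1 + x).  Put (1 + s x)(1 + t y) for a letter whose
   positions in u and w differ and 1 + t y for the others, and take the part that
   is linear in s.  If |u| = |w| = n it is P(L, R) x = 0, where L and R are the
   multiplications by 1 + t y and P <> 0 is homogeneous of degree n.  Writing
   P(T, 1) = (T - 1)^m Q(T) with Q(1) <> 0, the lowest coefficient in t gives
   Q(1) ad(y)^m x = 0.  If |u| <> |w|, the top coefficient in t of
   (1 + t y)^|u| = (1 + t y)^|w| shows that y is nilpotent.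

   From the Engel condition to nilpotency of the commutator ideal J.  By
   Shirshov's theorem every long word in the generators contains a high power or
   is divisible, and divisible words are combinations of smaller ones because the
   linearized Engel identity is multilinear with leading coefficient 1.  As
   y^e x is a combination of the y^i x y^(e-i), i < e, powers move to the right,
   so J^N is generated as a right ideal by products of N elements b [x_i, x_j]
   with b a short word.  Elements [a, b] r are nilpotent of index bounded in terms
   of e: otherwise a product ring has a non-nilpotent such element, hence a prime
   Engel quotient where it survives; but a prime Engel ring is a domain, and an
   Engel domain is commutative.  Shirshov's theorem applied to the elements
   b [x_i, x_j] now gives J^N = 0.

   Finally the ad(x_i) act on J^n / J^(n+1) as commuting nilpotent operators, so
   d e + 1 steps of the series gamma lead from J^n into J^(n+1). *)
Require Import Defs.
From HB Require Import structures.
From mathcomp Require Import all_boot all_order all_algebra.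
From mathcomp Require Import boolp zify.
Set Implicit Arguments. Unset Strict Implicit. Unset Printing Implicit Defensive.
Import Order.TTheory GRing.Theory.

(** * Shirshov's theorem on words *)

Definition has_power (T : eqType) k (w : seq T) :=
  exists p v s, v != [::] /\ w = p ++ flatten (nseq k v) ++ s.

(** Shirshov's divisibility, with the given arrangement as the largest one. The multilinear identity
    relies on [uniq]. *)
Definition divided disp (T : orderType disp) (us : seq (seq T)) :=
  [/\ uniq us, [::] \notin us & forall us', perm_eq us' us -> us' != us ->
      ((flatten us' : seqlexi T) < flatten us)%O].

Definition has_divided disp (T : orderType disp) m (w : seq T) :=
  exists p us s, [/\ size us = m, divided us & w = p ++ flatten us ++ s].

Lemma has_power_infix (T : eqType) k (p w s : seq T) :
  has_power k w -> has_power k (p ++ w ++ s).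
Proof.
case=> p' [v [s' [v0 ->]]]; exists (p ++ p'), v, (s' ++ s).
by rewrite -!catA.
Qed.

Lemma has_divided_infix disp (T : orderType disp) m (p w s : seq T) :
  has_divided m w -> has_divided m (p ++ w ++ s).
Proof.
case=> p' [us [s' [m_us dus ->]]]; exists (p ++ p'), us, (s' ++ s).
by rewrite -!catA.
Qed.

(** * Blocks ended by the largest letter *)

Section Blocks.
Variables (disp : Order.disp_t) (T : orderType disp) (a : T).

(** Blocks are the letters of the new alphabet in Shirshov's induction; [a] will be the largest
    letter of the word. *)
Definition is_block (b : seq T) :=
  exists u i, [/\ u != [::], all (fun c => c < a)%O u & b = u ++ nseq i.+1 a].

Lemma ltlexi_cat2l (p s t : seq T) :
  ((p ++ s : seqlexi T) < p ++ t)%O = ((s : seqlexi T) < t)%O.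
Proof. by elim: p => //= c p IH; rewrite ltxi_cons lexx /= IH. Qed.

Lemma block_head b : is_block b -> exists h b', b = h :: b' /\ (h < a)%O.
Proof.
by case=> [[|h u]] [i [//= _ /andP[ha _] ->]]; exists h, (u ++ nseq i.+1 a).
Qed.

Lemma block_last b : is_block b -> exists b', b = rcons b' a.
Proof.
case=> u [i [_ _ ->]]; exists (u ++ nseq i a).
by rewrite rcons_cat; congr (_ ++ _); elim: i => //= i {1}->.
Qed.

Lemma flatten_blocks_head (bs : seq (seq T)) :
  {in bs, forall b, is_block b} -> bs != [::] ->
  exists h t, flatten bs = h :: t /\ (h < a)%O.
Proof.
case: bs => //= b bs hb _; have [|h [b' [-> ha]]] := @block_head b.
  by apply: hb; rewrite mem_head.
by exists h, (b' ++ flatten bs).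
Qed.

Lemma block_index u i : all (fun c => c < a)%O u ->
  forall s, index a ((u ++ nseq i.+1 a) ++ s) = size u.
Proof.
move=> ua s; rewrite -catA index_cat ifN /= ?eqxx ?addn0 //.
by apply/negP => /(allP ua); rewrite ltxx.
Qed.

(** The first [a] has the same position in both blocks, and behind it a block consists of [a]
    alone. *)
Lemma block_prefix (x z : seq T) :
  is_block x -> is_block (x ++ z) -> all (pred1 a) z.
Proof.
move=> [u [i [_ ua ->]]] [u' [j [_ ua' e]]].
have su : size u = size u'.
  by rewrite -(block_index i ua z) e -(block_index j ua' [::]) cats0.
have := congr1 (drop (size u)) e.
rewrite -catA drop_size_cat // su drop_size_cat // => ez.
have : all (pred1 a) (nseq j.+1 a) by rewrite all_pred1_nseq.
by rewrite -ez all_cat => /andP[].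
Qed.

Lemma ltlexi_split (x y : seq T) : ((x : seqlexi T) < y)%O ->
  (exists c z, y = x ++ c :: z) \/
  (forall s t, ((x ++ s : seqlexi T) < y ++ t)%O).
Proof.
elim: x y => [|c x IH] [|c' y] //=.
  by move=> _; left; exists c', y.
rewrite ltxi_cons => /andP[le_cc' /implyP h].
have [cc'|cc'] := boolP (c' <= c)%O.
  have ec : c = c' by apply/le_anti; rewrite le_cc' cc'.
  case: (IH _ (h cc')) => [[c1 [z ->]]|H].
    by left; exists c1, z; rewrite ec.
  by right=> s t; rewrite ltxi_cons le_cc' /= H implybT.
by right=> s t; rewrite ltxi_cons le_cc' /= (negbTE cc').
Qed.

(** The critical case is a block [x] that is a proper prefix of [y]: then [y] continues with [a],
    while the other word continues with a new block, whose first letter is below [a]. *)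
Lemma ltlexi_flatten_blocks (P Q : seq (seq T)) :
  {in P, forall b, is_block b} -> {in Q, forall b, is_block b} ->
  size (flatten P) = size (flatten Q) ->
  ((P : seqlexi (seqlexi T)) < Q)%O ->
  ((flatten P : seqlexi T) < flatten Q)%O.
Proof.
elim: P Q => [|x P IH] [|y Q] //= hP hQ.
  have [|h [b' [-> _]]] := @block_head y; first by apply: hQ; rewrite mem_head.
  by [].
have hP' : {in P, forall b, is_block b}.
  by move=> b bP; apply: hP; rewrite inE bP orbT.
have hQ' : {in Q, forall b, is_block b}.
  by move=> b bP; apply: hQ; rewrite inE bP orbT.
have hx : is_block x by apply: hP; rewrite mem_head.
have hy : is_block y by apply: hQ; rewrite mem_head.
rewrite !size_cat => esz; rewrite ltxi_cons => /andP[le_xy /implyP hlt].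
have [yx|yx] := boolP ((y : seqlexi T) <= x)%O.
  have exy : x = y by apply: (@le_anti _ (seqlexi T)); rewrite le_xy yx.
  rewrite -exy ltlexi_cat2l; apply: IH => //; last exact: hlt.
  by apply: (@addnI (size x)); rewrite {2}exy.
have {hlt} lt_xy : ((x : seqlexi T) < y)%O by rewrite ltNge yx.
have [[c [z ey]]|//] := ltlexi_split lt_xy.
have : all (pred1 a) (c :: z) by apply: (@block_prefix x); rewrite -?ey.
case/andP=> /eqP ec _; rewrite ey ec -catA ltlexi_cat2l.
(* Equal total lengths exclude that [P] ends here. *)
case: P {IH hP} hP' esz => [|b P] hP' esz.
  by move: esz; rewrite ey !size_cat /=; lia.
have [//|h [t [-> ha]]] := flatten_blocks_head hP'.
by rewrite ltxi_cons (ltW ha) /= leNgt ha.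
Qed.

Lemma flatten_blocks_inj (P Q : seq (seq T)) :
  {in P, forall b, is_block b} -> {in Q, forall b, is_block b} ->
  flatten P = flatten Q -> P = Q.
Proof.
move=> hP hQ e; have [lt|lt|//] := @ltgtP _ (seqlexi (seqlexi T)) P Q.
- by have := ltlexi_flatten_blocks hP hQ (congr1 size e) lt; rewrite e ltxx.
- have := ltlexi_flatten_blocks hQ hP (esym (congr1 size e)) lt.
  by rewrite e ltxx.
Qed.

Lemma block_decomposition (w : seq T) : all (fun c => c <= a)%O w ->
  exists i bs u, [/\ {in bs, forall b, is_block b}, all (fun c => c < a)%O u
    & w = nseq i a ++ flatten bs ++ u].
Proof.
elim: w => [|c w IH] /=; first by exists 0%N, [::], [::].
case/andP=> ca /IH[i [bs [u [hbs hu ->]]]].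
have [->|nca] := eqVneq c a; first by exists i.+1, bs, u.
have lca : (c < a)%O by rewrite lt_neqAle nca.
case: i => [|i].
  case: bs hbs => [|b bs] hbs; first by exists 0%N, [::], (c :: u) => /=; rewrite lca.
  exists 0%N, ((c :: b) :: bs), u; split=> // b'; rewrite inE => /predU1P[->|b'bs].
    have [v [j [v0 va ->]]] := hbs b (mem_head _ _).
    by exists (c :: v), j => /=; rewrite lca.
  by apply: hbs; rewrite inE b'bs orbT.
exists 0%N, ((c :: nseq i.+1 a) :: bs), u; split=> //=; last by rewrite -catA.
move=> b'; rewrite inE => /predU1P[->|/hbs //].
by exists [:: c], i; rewrite /= lca.
Qed.

(** The letter [a] supplies one more factor: a rearrangement that does not start with it starts with
    a smaller letter, and the others permute words in blocks, whose order survives flattening. *)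
Lemma divided_blocks (us : seq (seq (seq T))) :
  {in flatten us, forall b, is_block b} ->
  @divided _ (seqlexi T) us -> divided ([:: a] :: map flatten us).
Proof.
move=> hus [Uus nus dus].
have hv v : v \in us -> {in v, forall b, is_block b}.
  by move=> vus b bv; apply: hus; apply/flattenP; exists v.
have hh v : v \in us -> exists h t, flatten v = h :: t /\ (h < a)%O.
  move=> vus; apply: flatten_blocks_head; first exact: hv.
  by apply: contraNneq nus => <-.
split.
- rewrite /= map_inj_in_uniq ?Uus ?andbT; last first.
    by move=> v v' /hv h1 /hv h2; apply: flatten_blocks_inj.
  by apply/negP => /mapP[v /hh[h [t [-> ha]]]] [ea]; rewrite ea ltxx in ha.
- by rewrite inE /=; apply/negP => /mapP[v /hh[h [t [-> ha]]]].
move=> [|h us'] pus nus'; first by have := perm_size pus.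
have : h \in [:: a] :: map flatten us by rewrite -(perm_mem pus) mem_head.
rewrite inE => /predU1P[eh|/mapP[v /hh[c [t [ec ca]]] eh]]; last first.
  by rewrite /= eh ec /= ltxi_cons (ltW ca) /= leNgt ca.
move: pus nus'; rewrite eh perm_cons eqseq_cons eqxx /= => pus nus'.
rewrite ltxi_cons lexx /=.
have /(perm_iotaP [::])[Is pIs eus'] := pus.
rewrite size_map in pIs.
have eus2 : us' = map flatten (map (nth [::] us) Is).
  rewrite eus' -map_comp; apply/eq_in_map => i; rewrite (perm_mem pIs).
  by rewrite mem_iota /= => ilt; rewrite (nth_map [::]).
have pus2 : perm_eq (map (nth [::] us) Is) us.
  by apply/(perm_iotaP [::]); exists Is.
have flat2 (ss : seq (seq (seq T))) :
    flatten (map flatten ss) = flatten (flatten ss).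
  by elim: ss => //= s ss ->; rewrite flatten_cat.
rewrite eus2 !flat2; apply: ltlexi_flatten_blocks => //.
- move=> b bf; apply: hus; rewrite -(perm_mem (perm_flatten pus2)) //.
- apply/perm_size/perm_flatten/perm_flatten; exact: pus2.
- by apply: dus => //; apply: contraNneq nus' => e; rewrite eus2 e.
Qed.

End Blocks.

Definition words_upto (T : Type) (A : seq T) n : seq (seq T) :=
  iter n (fun ws => [::] :: [seq c :: w | c <- A, w <- ws]) [:: [::]].

Lemma size_words_upto (T : Type) (A : seq T) n d : size A <= d ->
  size (words_upto A n) <= iter n (fun s => (d * s).+1) 1%N.
Proof.
by move=> Ad; elim: n => //= n IH; rewrite size_allpairs ltnS leq_mul.
Qed.

Lemma mem_words_upto (T : eqType) (A : seq T) n (w : seq T) :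
  {subset w <= A} -> size w <= n -> w \in words_upto A n.
Proof.
elim: n w => [|n IH] [|c w] //= wA sw.
rewrite inE; apply/orP; right; apply/allpairsP; exists (c, w); split=> //=.
  by apply: wA; rewrite mem_head.
by apply: IH => // x xw; apply: wA; rewrite inE xw orbT.
Qed.

Lemma seq_max disp (T : orderType disp) (A : seq T) : A != [::] ->
  exists2 a, a \in A & {in A, forall c, (c <= a)%O}.
Proof.
elim: A => //= c [|c' A] IH _.
  by exists c; rewrite ?mem_head // => x; rewrite inE => /eqP ->.
have [//|a aA ha] := IH.
have [ca|ac] := leP c a.
  by exists a; [by rewrite inE aA orbT | move=> x; rewrite inE => /predU1P[->|/ha]].
exists c; first exact: mem_head.
by move=> x; rewrite inE => /predU1P[->//|/ha xa]; apply: le_trans xa (ltW ac).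
Qed.

Lemma leq_size_flatten (T : Type) (bs : seq (seq T)) n :
  all (fun b => size b <= n) bs -> size (flatten bs) <= size bs * n.
Proof.
by elim: bs => //= b bs IH /andP[bn /IH h]; rewrite size_cat mulSn leq_add.
Qed.

(** Double induction, on [m] and on the alphabet size [d]. If runs avoiding the largest letter [a]
    and powers of [a] are short, the blocks have bounded length and form an alphabet of bounded
    size, so the case [m] applies to the word in blocks. *)
Theorem shirshov k m d : exists L, forall disp (T : orderType disp) (A w : seq T),
  size A <= d -> {subset w <= A} -> L <= size w ->
  has_power k w \/ has_divided m w.
Proof.
elim: m d => [|m IHm] d.
  exists 0%N => disp T A w _ _ _; right; exists [::], [::], w; split=> //.
  by split=> // us' /perm_size; case: us'.
elim: d => [|d [N IHd]].
  by exists 1%N => disp T [|//] [|x w] // _ /(_ x); rewrite mem_head => /(_ isT).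
(* The iterate bounds the number of words of length at most [N + k], which is the size of the
   alphabet of blocks. *)
have [L2 HL2] := IHm (iter (N + k) (fun s => (d.+1 * s).+1) 1%N).
(* Enough for more than [L2] blocks besides the initial power of [a] and the tail without [a]. *)
exists (L2.+2 * (N + k)).+1 => disp T A w Ad wA Lw.
have [a aA maxa] : exists2 a, a \in A & {in A, forall c, (c <= a)%O}.
  apply: seq_max; apply: contraTneq Lw => A0.
  by case: w wA => // x w /(_ x); rewrite A0 mem_head => /(_ isT).
have [|i [bs [u [hbs ua ew]]]] := @block_decomposition _ _ a w.
  by apply/allP => c /wA /maxa.
have [k0|k_gt0] := posnP k.
  left; exists [::], w, w; split; last by rewrite k0.
  by apply: contraTneq Lw => ->.
have small v : infix v w -> all (fun c => c < a)%O v ->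
    (has_power k w \/ has_divided m.+1 w) \/ size v < N.
  case/infixP => p [s evw] va; have [Nv|] := leqP N (size v); last by right.
  left; have [] := IHd _ T [seq c <- A | (c < a)%O] v.
  - rewrite -ltnS (leq_trans _ Ad) // size_filter -(count_predC (fun c => c < a)%O A).
    rewrite -addn1 leq_add2l -has_count; apply/hasP; exists a => //=.
    by rewrite ltxx.
  - move=> c cv; rewrite mem_filter (allP va) //=; apply: wA.
    by rewrite evw !mem_cat cv orbT.
  - exact: Nv.
  - by rewrite evw; left; apply: has_power_infix.
  - by rewrite evw; right; apply: has_divided_infix.
have apow j : infix (nseq j a) w -> (has_power k w) \/ j < k.
  case/infixP => p [s evw]; have [kj|] := leqP k j; last by right.
  left; exists p, [:: a], (nseq (j - k) a ++ s); split=> //.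
  rewrite evw -{1}(subnKC kj) nseqD -catA; congr (_ ++ (_ ++ _)).
  by elim: (k) => //= k' ->.
have infixb b : b \in bs -> infix b w.
  move=> bbs; have [bs1 [bs2 ebs]] : exists bs1 bs2, bs = bs1 ++ b :: bs2.
    by case/splitPr: bbs => bs1 bs2; exists bs1, bs2.
  apply/infixP; by exists (nseq i a ++ flatten bs1), (flatten bs2 ++ u);
    rewrite ew ebs flatten_cat /= -!catA.
have [hb|/allPn[b bbs]] := boolP (all (fun b => size b <= N + k) bs); last first.
  have [v [j [_ va eb]]] := hbs b bbs.
  have /infixP[p [s]] := infixb b bbs; rewrite eb => ewb.
  have [|//|vN] := small v _ va.
    by apply/infixP; exists p, (nseq j.+1 a ++ s); rewrite ewb -!catA.
  have [|?|jk] := apow j.+1.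
  - by apply/infixP; exists (p ++ v), s; rewrite ewb -!catA.
  - by left.
  by rewrite size_cat size_nseq leq_add // ltnW.
have [|//|uN] := small u _ ua.
  by apply/infixP; exists (nseq i a ++ flatten bs), [::]; rewrite ew cats0 -catA.
have [|?|ik] := apow i.
- by apply/infixP; exists [::], (flatten bs ++ u); rewrite ew.
- by left.
have Lbs : L2.+1 <= size bs.
  rewrite ltnNge; apply/negP => bsL; move: Lw; rewrite ltnNge => /negP; apply.
  rewrite ew !size_cat size_nseq 2!mulSn.
  have := leq_size_flatten hb; have : size bs * (N + k) <= L2 * (N + k).
    by rewrite leq_mul2r bsL orbT.
  move=> h1 /leq_trans/(_ h1); move: (size _) (size _) (L2 * _) uN ik => ? ? ?; lia.
(* The first block is set aside: it guarantees a letter [a] in front of the divided factors, which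
   serves as the additional factor. *)
case: bs hbs ew infixb hb Lbs => //= b0 bs hbs ew infixb /andP[_ hb] Lbs.
have hbs' : {in bs, forall b, is_block a b}.
  by move=> b bbs; apply: hbs; rewrite inE bbs orbT.
have [|||pow|div] := HL2 _ (seqlexi T) (words_upto A (N + k)) bs.
- exact: size_words_upto.
- move=> b bbs; apply: mem_words_upto; last exact: (allP hb).
  have /infixP[p [s e]] : infix b w by apply: infixb; rewrite inE bbs orbT.
  by move=> x xb; apply: wA; rewrite e !mem_cat xb orbT.
- exact: Lbs.
- left; case: pow => p [v [s [v0 ebs]]].
  have fpow : flatten (flatten (nseq k v)) = flatten (nseq k (flatten v)).
    by elim: (k) => //= k' IH; rewrite flatten_cat IH.
  exists (nseq i a ++ b0 ++ flatten p), (flatten v), (flatten s ++ u); split.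
    have [||h [t [->]] //] := @flatten_blocks_head _ _ a v => //.
    move=> b bv; apply: hbs'; rewrite ebs -(prednK k_gt0) /= !mem_cat bv.
    by rewrite orbT.
  by rewrite ew ebs !flatten_cat fpow -!catA.
- right; case: div => p [us [s [sus dus ebs]]].
  have [q eq] : exists q, b0 ++ flatten p = rcons q a.
    have [b0' eb0] := block_last (hbs b0 (mem_head _ _)).
    elim/last_ind: p ebs {dus} => [|p b _] ebs; first by exists b0'; rewrite cats0.
    have [|b' eb] := @block_last _ _ a b.
      by apply: hbs'; rewrite ebs mem_cat mem_rcons mem_head.
    by exists (b0 ++ flatten p ++ b'); rewrite flatten_rcons eb !rcons_cat.
  exists (nseq i a ++ q), ([:: a] :: map flatten us), (flatten s ++ u); split.
  - by rewrite /= size_map sus.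
  - apply: divided_blocks => // b bus; apply: hbs'.
    by rewrite ebs !mem_cat bus orbT.
  have flat2 : flatten (map flatten us) = flatten (flatten us).
    by elim: (us) => //= v us' ->; rewrite flatten_cat.
  rewrite ew ebs !flatten_cat -flat2 -!catA (catA b0) eq -cats1 -!catA.
  by [].
Qed.


Local Open Scope ring_scope.

(** * Engel rings *)

Definition lie (S : pzRingType) (y x : S) := y * x - x * y.

Definition engel (e : nat) (S : pzRingType) :=
  forall y x : S, iter e (lie y) x = 0.

(** Pascal's rule for a two-parameter family; it yields both the expansion of ad(y)^n and the
    Leibniz formula. *)
Lemma iter_binomial (V : zmodType) (D : {additive V -> V}) (h : nat -> nat -> V) :
  (forall i j, D (h i j) = h i.+1 j + h i j.+1) ->
  forall n i j, iter n D (h i j) = \sum_(l < n.+1) h (i + (n - l))%N (j + l)%N *+ 'C(n, l).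
Proof.
move=> hD; have iterD n : {morph iter n D : x y / x + y}.
  by elim: n => [//|n IH] x y; rewrite !iterS IH raddfD.
elim=> [|n IH] i j; first by rewrite big_ord1 /= !addn0.
rewrite iterSr hD iterD !IH.
rewrite [in RHS]big_ord_recl [in RHS]big_ord_recr [X in X + _ = _]big_ord_recl.
rewrite [X in _ + X = _]big_ord_recr /= !addn0 !subn0 !bin0 !binn !subnn !addn0.
rewrite !addSnnS -!addrA; congr (_ + _); rewrite !addrA; congr (_ + _).
rewrite -big_split /=; apply: eq_bigr => l _.
rewrite /bump /= !add1n binS mulrnDr subSS addrC !addSnnS.
by rewrite addrC subnSK.
Qed.

Section LieRing.
Variable S : pzRingType.
Implicit Types x y z : S.

Fact lie_is_additive y : additive (@lie S y).
Proof. 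
move=> x z; rewrite /lie mulrBr mulrBl !opprB addrACA [RHS]addrACA.
by rewrite [- _ - _ in RHS]addrC. Qed.
HB.instance Definition _ y := GRing.isAdditive.Build S S (@lie S y) (lie_is_additive y).

Lemma iter_lie0 n y : iter n (lie y) 0 = 0.
Proof. by elim: n => [//|n IH]; rewrite iterS IH raddf0. Qed.

Lemma lie_mul y x z : lie y (x * z) = lie y x * z + x * lie y z.
Proof. by rewrite /lie mulrBl mulrBr !mulrA addrA subrK. Qed.

Lemma iter_lie y n x : iter n (lie y) x =
  \sum_(l < n.+1) (-1) ^+ l * (y ^+ (n - l) * x * y ^+ l) *+ 'C(n, l).
Proof.
pose h i j := (-1) ^+ j * (y ^+ i * x * y ^+ j).
have {1}-> : x = h 0%N 0%N by rewrite /h !expr0 !mul1r mulr1.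
have hD i j : lie y (h i j) = h i.+1 j + h i j.+1; last exact: iter_binomial.
rewrite /h /lie exprS [y ^+ j.+1]exprSr [(-1) ^+ j.+1]exprS mulN1r mulNr !mulrA.
congr (_ - _). by rewrite -(commrX _ (commrN1 y)).
Qed.

Lemma leibniz y n x z : iter n (lie y) (x * z) =
  \sum_(l < n.+1) (iter (n - l) (lie y) x * iter l (lie y) z) *+ 'C(n, l).
Proof.
pose h i j := iter i (lie y) x * iter j (lie y) z.
have hD i j : lie y (h i j) = h i.+1 j + h i j.+1 by exact: lie_mul.
exact: (iter_binomial hD n 0 0).
Qed.

End LieRing.

Section Domain.
Variables (S : pzRingType) (e : nat).
Hypothesis domS : forall x y : S, x * y = 0 -> x = 0 \/ y = 0.
Hypothesis engS : engel e S.

Lemma domain_expr_eq0 (x : S) n : x ^+ n = 0 -> x = 0.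
Proof.
elim: n => [|n IH]; last by rewrite exprS => /domS[].
by rewrite expr0 => x0; rewrite -[x]mulr1 x0 mulr0.
Qed.

(** Only the two outer terms of the expansion survive. Evaluating at 1 gives (-1)^n y^n = - y^n,
    which settles the sign for every parity and characteristic. *)
Lemma iter_lie_sub (y x : S) n : (0 < n)%N ->
  (forall l, (0 < l < n)%N -> 'C(n, l)%:R = 0 :> S) ->
  iter n (lie y) x = lie (y ^+ n) x.
Proof.
case: n => // n _ hC.
have E z : iter n.+1 (lie y) z = y ^+ n.+1 * z + (-1) ^+ n.+1 * (z * y ^+ n.+1).
  rewrite iter_lie big_ord_recl big_ord_recr /= big1 => [|l _].
    by rewrite add0r /bump add1n subn0 subnn !expr0 !mul1r mulr1 bin0 binn !mulr1n.
  by rewrite -mulr_natr hC ?mulr0 // /bump /= add1n ltnS ltn_ord.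
rewrite E; have := E 1; rewrite iterSr [lie y 1]/lie mulr1 mul1r subrr.
rewrite iter_lie0 mulr1 mul1r => /esym yn.
have sgn : (-1) ^+ n.+1 * (x * y ^+ n.+1) = x * ((-1) ^+ n.+1 * y ^+ n.+1).
  by rewrite !mulrA (commrX _ (commrN1 x)).
by rewrite sgn -(addr0_eq yn) mulrN.
Qed.

(** The exponent killing ad(y) is lowered from n + 2 to n + 1 until it is 1. A nonzero value [c] of
    ad(y)^(n+1) would make large powers central, and then an element [t] with [t, y] = - c^q y
    violates the Engel condition. *)
Lemma engel_domain (x y : S) : lie y x = 0.
Proof.
suff H n : (forall z, iter n (lie y) z = 0) -> forall z, lie y z = 0.
  by apply: (H e).
elim: n => [h z|[//|n] IH hn]; first by rewrite -[lie y z]/(iter 0 (lie y) _) h.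
apply: IH => z0; apply: contrapT => c0.
set c := iter n.+1 (lie y) z0 in c0.
have yc : lie y c = 0 by exact: (hn z0).
have hn' l z : (n.+2 <= l)%N -> iter l (lie y) z = 0.
  by move=> /subnK <-; rewrite iterD hn iter_lie0.
(* In the Leibniz expansion of ad(y)^(n+2) on this product, all terms but one contain some ad(y)^j
   z0 with j >= n + 2; the remaining one is the binomial coefficient times c^2. *)
have binom0 a : (a < n.+1)%N -> 'C(n.+2, a.+1)%:R = 0 :> S.
  move=> an; have an2 : (a.+1 < n.+3)%N by rewrite ltnS ltnW.
  have := hn (iter a (lie y) z0 * iter (n - a) (lie y) z0).
  rewrite leibniz (bigD1 (Ordinal an2)) //=.
  rewrite big1 => [|l]; last first.
    rewrite -val_eqE /= neq_ltn => /orP[] la; rewrite -!iterD.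
      by rewrite [X in X * _]hn' ?mul0r ?mul0rn //; lia.
    by rewrite [X in _ * X]hn' ?mulr0 ?mul0rn //; lia.
  have an1 : (a <= n)%N by rewrite -ltnS.
  rewrite addr0 -!iterD (subnKC an1) !subSS subnK ?(ltnW an) //.
  by rewrite -mulr_natr => /domS[/domS[]|].
(* The exponent n + 2 now behaves like a prime characteristic, and ad(w)^(n+2) = ad(w^(n+2)) can be
   iterated. *)
have frob k (w x0 : S) : iter (n.+2 ^ k) (lie w) x0 = lie (w ^+ (n.+2 ^ k)) x0.
  elim: k x0 => [|k IHk] x0; first by rewrite expr1.
  have eqk : iter (n.+2 ^ k) (lie w) =1 lie (w ^+ (n.+2 ^ k)) by [].
  rewrite expnS iterM (eq_iter eqk) mulnC exprM; apply: iter_lie_sub => // l.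
  by case: l => // l /andP[_ ln]; apply: binom0.
(* As [q] exceeds [e], the Engel condition makes every q-th power central. *)
set q := (n.+2 ^ e)%N in frob *.
have e_lt_q : (e < q)%N by apply: ltn_expl.
have cq (u : S) : c ^+ q * u = u * c ^+ q.
  apply/eqP; rewrite -subr_eq0 -[_ - _]/(lie _ _) -frob -/q -(subnK (ltnW e_lt_q)).
  by rewrite iterD engS iter_lie0.
pose z' := iter n (lie y) z0.
have ec : c = y * z' - z' * y by [].
(* Since c = [y, z'] commutes with [y], this gives [t, y] = - c^q y, and each further ad(t)
   multiplies by the central element - c^q. *)
pose t := c ^+ q.-1 * z' * y.
have ycq k : y * c ^+ k = c ^+ k * y.
  by apply: commrX; apply/eqP; rewrite -subr_eq0; apply/eqP.
have lty : lie t y = - c ^+ q * y.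
  rewrite /lie /t [y * _]mulrA [y * _]mulrA ycq -!mulrA -mulrBr !mulrA.
  rewrite -[z' * y * y - _]mulrBl -[z' * y - _]opprB -ec.
  by rewrite !mulNr mulrN mulrA -exprSr prednK // (leq_trans _ e_lt_q).
have ltn i : iter i (lie t) y = (- c ^+ q) ^+ i * y.
  elim: i => [|i IHi]; first by rewrite mul1r.
  have gt : GRing.comm t ((- c ^+ q) ^+ i).
    by apply/commrX/commrN; rewrite /GRing.comm cq.
  rewrite iterS IHi /lie mulrA gt -[_ * t * y]mulrA -[_ * y * t]mulrA -mulrBr.
  by rewrite -/(lie t y) lty mulrA -exprSr.
have [cq0|y0] : c ^+ q = 0 \/ y = 0.
- have /domS[h|->] : (- c ^+ q) ^+ e * y = 0 by rewrite -ltn engS.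
    by left; apply/eqP; rewrite -oppr_eq0; apply/eqP/(domain_expr_eq0 h).
  by right.
- exact/c0/(domain_expr_eq0 cq0).
- by apply: c0; rewrite ec y0 mulr0 mul0r subr0.
Qed.
End Domain.

(** * Prime Engel rings are domains *)

Section Prime.
Variable S : pzRingType.
Implicit Types x y a : S.

(** Levitzki's lemma: in a semiprime ring a right ideal [a S] that is nil of bounded index vanishes.
    The induction hypothesis serves twice, to show u = (a r0)^(m+1) a = 0 for all r0, and then for
    [a] itself. *)
Lemma semiprime_nil (m : nat) a :
  (forall x, (forall r, x * r * x = 0) -> x = 0) ->
  (forall r, (a * r) ^+ m * a = 0) -> a = 0.
Proof.
move=> semiS; elim: m a => [|[|m] IH] a ha.
- by have := ha 0; rewrite mul1r.
- by apply: semiS.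
apply: (IH) => r0; set X := a * r0; set u := X ^+ m.+1 * a.
have Xa j : X ^+ (j + m.+2) * a = 0 by rewrite exprD -mulrA ha mulr0.
apply: IH => r; set p := a * (r * X ^+ m.+1).
have pa k : exists s, p ^+ k * a = a * s.
  case: k => [|k]; first by exists 1; rewrite mul1r mulr1.
  by exists (r * X ^+ m.+1 * (p ^+ k * a)); rewrite exprS -!mulrA.
have Xpa j k : X ^+ (j + m.+2) * (p ^+ k * a) = 0.
  by have [s ->] := pa k; rewrite mulrA Xa mul0r.
have up i : (u * r) ^+ i * u = X ^+ m.+1 * (p ^+ i * a).
  elim: i => [|i IHi]; first by rewrite !mul1r.
  have urX : u * r * X ^+ m.+1 = X ^+ m.+1 * p by rewrite /u /p !mulrA.
  by rewrite [(u * r) ^+ _]exprS -mulrA IHi [p ^+ i.+1]exprS !mulrA urX.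
have pXpa l k : p * (X ^+ l.+1 * (p ^+ k * a)) = 0.
  by rewrite /p -!mulrA (mulrA (X ^+ m.+1)) -exprD addnC addSnnS Xpa !mulr0.
(* Terms with a [p] to the left of an [X] vanish by [pXpa]. *)
have mix n : (X + p) ^+ n * a = \sum_(l < n.+1) X ^+ l * (p ^+ (n - l) * a).
  elim: n => [|n IHn]; first by rewrite big_ord1 !mul1r.
  rewrite exprS -mulrA IHn mulrDl [RHS]big_ord_recl mul1r subn0 addrC.
  congr (_ + _); rewrite mulr_sumr; last first.
    by apply: eq_bigr => l _; rewrite mulrA -exprS lift0 subSS.
  rewrite big_ord_recl big1 => [|l _]; last by rewrite lift0 pXpa.
  by rewrite addr0 mul1r subn0 mulrA -exprS.
(* After multiplication by X^m, terms with two or more [X] vanish, the one without [X] contains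
   p^(m+2) a = 0, and the one with a single [X] is (u r)^(m+1) u. *)
have := ha (r0 + r * X ^+ m.+1); rewrite mulrDr -/X -/p mix.
move/(congr1 (fun z => X ^+ m * z)); rewrite mulr0 mulr_sumr.
rewrite 2!big_ord_recl big1 => [|l _]; last first.
  by rewrite !lift0 mulrA -exprD addnC !addSnnS Xpa.
have pM : p ^+ m.+2 * a = 0 by apply: ha.
by rewrite up subn0 pM !mulr0 add0r addr0 mulrA -exprD addn1 subSS subn0.
Qed.

Definition prime_ring := forall x y, (forall r, x * r * y = 0) -> x = 0 \/ y = 0.

(** If a^2 = 0 then ad(a r)^i a = (a r)^i a, so [semiprime_nil] makes the ring reduced. Then x y = 0
    gives (y x)^2 = 0, next (x r y)^2 = 0, hence x S y = 0. *)
Lemma engel_prime_domain e : prime_ring -> engel e S ->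
  forall x y, x * y = 0 -> x = 0 \/ y = 0.
Proof.
move=> primeS engS.
have red a : a * a = 0 -> a = 0.
  move=> aa; apply: (@semiprime_nil e) => [x h|r]; first by case: (primeS x x h).
  rewrite -[RHS](engS (a * r) a).
  elim: e {engS} => [|i IH]; first by rewrite mul1r.
  rewrite iterS -IH /lie -[_ * a * (a * r)]mulrA (mulrA a a) aa mul0r mulr0 subr0.
  by rewrite exprS mulrA.
move=> x y xy; apply: primeS => r; apply: (red).
have yx : y * x = 0 by apply: red; rewrite -mulrA (mulrA x) xy mul0r mulr0.
by rewrite -!mulrA (mulrA y x) yx mul0r !mulr0.
Qed.

End Prime.

(** * Multilinear form of the Engel identity *)

(** Membership in a span is expressed by quantifying over the subgroups that contain the spanning
    elements. *)
Definition subgroup (V : zmodType) (G : V -> Prop) :=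
  G 0 /\ forall x y, G x -> G y -> G (x - y).

Lemma subgroupN (V : zmodType) (G : V -> Prop) x : subgroup G -> G x -> G (- x).
Proof. by move=> [G0 GB] Gx; rewrite -[- x]sub0r; apply: GB. Qed.

Lemma subgroupD (V : zmodType) (G : V -> Prop) x y :
  subgroup G -> G x -> G y -> G (x + y).
Proof.
by move=> sG Gx Gy; rewrite -[y]opprK; apply: (sG.2) => //; apply: subgroupN.
Qed.

Lemma subgroup_sum (V : zmodType) (G : V -> Prop) (I : eqType) (r : seq I)
  (P : pred I) (F : I -> V) : subgroup G ->
  (forall i, i \in r -> P i -> G (F i)) -> G (\sum_(i <- r | P i) F i).
Proof.
move=> sG GF; rewrite big_seq_cond; apply: big_ind => [|x y|i /andP[]].
- exact: (sG.1).
- exact: subgroupD.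
- exact: GF.
Qed.

Lemma subgroup_mul (S : pzRingType) (G : S -> Prop) (a b : S) :
  subgroup G -> subgroup (fun x => G (a * x * b)).
Proof.
move=> [G0 GB]; split=> [|x y Gx Gy]; first by rewrite mulr0 mul0r.
by rewrite mulrBr mulrBl; apply: GB.
Qed.

Lemma subgroup_mull (S : pzRingType) (G : S -> Prop) (a : S) :
  subgroup G -> subgroup (fun x => G (a * x)).
Proof. by move=> [G0 GB]; split=> [|x y Gx Gy]; rewrite ?mulr0 ?mulrBr //; apply: GB. Qed.

Lemma subgroup_mulr (S : pzRingType) (G : S -> Prop) (a : S) :
  subgroup G -> subgroup (fun x => G (x * a)).
Proof. by move=> [G0 GB]; split=> [|x y Gx Gy]; rewrite ?mul0r ?mulrBl //; apply: GB. Qed.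

Fixpoint words (T : Type) (A : seq T) n : seq (seq T) :=
  if n is n'.+1 then [seq c :: w | c <- A, w <- words A n'] else [:: [::]].

Lemma mem_words (T : eqType) (A : seq T) n w :
  (w \in words A n) = (size w == n) && all (fun c => c \in A) w.
Proof.
elim: n w => [|n IH] [|c w] //=; first by apply/allpairsP => -[[? ?] []].
apply/allpairsP/idP => [[[c' w'] [/= cA ww [-> ->]]]|/and3P[sw cA wA]].
  by rewrite cA /= eqSS -IH.
by exists (c, w); split=> //=; rewrite IH -eqSS sw.
Qed.

Lemma words_uniq (T : eqType) (A : seq T) n : uniq A -> uniq (words A n).
Proof.
move=> uA; elim: n => //= n IH; apply: allpairs_uniq => //.
by move=> [c w] [c' w'] _ _ [-> ->].
Qed.

Section Polarization.
Variables (S : pzRingType) (e : nat).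
Implicit Types (y : 'I_e -> S) (x : S).

Definition ads y (s : seq 'I_e) x := foldr (fun i => lie (y i)) x s.

Lemma iter_lie_sum y (A : {set 'I_e}) n x :
  iter n (lie (\sum_(i in A) y i)) x =
  \sum_(s <- words (enum 'I_e) n | all (fun i => i \in A) s) ads y s x.
Proof.
elim: n => [|n IH]; first by rewrite /= big_cons big_nil addr0.
rewrite iterS IH raddf_sum [RHS]big_mkcond big_allpairs_dep /= exchange_big /=.
rewrite big_mkcond; apply: eq_bigr => s _; case: ifP => sA; last first.
  by rewrite big1 // => i _; rewrite andbF.
under [RHS]eq_bigr => i _ do rewrite andbT.
rewrite -big_mkcond big_enum_cond /= /lie mulr_suml mulr_sumr -sumrB.
by apply: eq_bigl => i; rewrite ?inE.
Qed.

(** Adding or removing [i0] pairs subsets of opposite sign. *)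
Lemma alternating_subsets (i0 : 'I_e) (s : seq 'I_e) : i0 \notin s ->
  \sum_(A : {set 'I_e} | all (fun i => i \in A) s) (-1) ^+ #|A| = 0 :> S.
Proof.
move=> i0s; rewrite (bigID (fun A : {set 'I_e} => i0 \in A)) /=.
rewrite (reindex_onto (fun A : {set 'I_e} => i0 |: A) (fun A => A :\ i0)) /=; last first.
  by move=> A /andP[_ i0A]; rewrite setD1K.
rewrite (eq_bigl (fun A : {set 'I_e} => all (fun i => i \in A) s && (i0 \notin A))) => [|A].
  rewrite -big_split big1 //= => A /andP[_ i0A].
  by rewrite cardsU1 i0A add1n exprS mulN1r addNr.
rewrite setU11 andbT; have [i0A|i0A] := boolP (i0 \in A).
  rewrite andbF; apply/negbTE/negP => /andP[_ /eqP e0].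
  by move: i0A; rewrite -e0 setD11.
rewrite setU1K // eqxx !andbT; apply: eq_in_all => i si; rewrite in_setU1.
by case: eqP => // ii0; rewrite -ii0 si in i0s.
Qed.

(** Inclusion-exclusion over the partial sums of the [y i]: words of length [e] that miss a variable
    cancel, and only permutations of all variables remain. *)
Lemma polarization y x : engel e S ->
  \sum_(s <- words (enum 'I_e) e | perm_eq s (enum 'I_e)) ads y s x = 0.
Proof.
move=> engS.
have : \sum_(A : {set 'I_e}) (-1) ^+ #|A| * iter e (lie (\sum_(i in A) y i)) x = 0.
  by rewrite big1 // => A _; rewrite engS mulr0.
under eq_bigr => A _ do rewrite iter_lie_sum mulr_sumr.
rewrite (exchange_big_dep predT) //=.
under eq_bigr => s _ do rewrite -mulr_suml.
rewrite (bigID (fun s => perm_eq s (enum 'I_e))) /= [X in _ + X]big_seq_cond.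
rewrite [X in _ + X]big1 ?addr0 => [|s /andP[ws ps]]; last first.
  have [i0 i0s] : exists i0, i0 \notin s.
    apply/existsP; rewrite -negb_forall; apply: contra ps => /forallP ps.
    rewrite uniq_perm ?enum_uniq // => [|i]; last by rewrite ps mem_enum.
    apply: (leq_size_uniq (enum_uniq 'I_e)) => [i _|]; first exact: ps.
    by move: ws; rewrite mem_words size_enum_ord => /andP[/eqP-> _].
  by rewrite (alternating_subsets i0s) mul0r.
move/(congr1 (fun z => (-1) ^+ e * z)); rewrite mulr0 mulr_sumr => H; rewrite -[RHS]H.
apply: eq_bigr => s ps; rewrite (big_pred1 [set: 'I_e]) => [|A].
  by rewrite cardsT card_ord mulrA -exprD addnn -mul2n exprM sqrrN expr1n expr1n mul1r.
apply/allP/eqP => [sA|-> j _]; last by rewrite inE.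
by apply/setP => i; rewrite inE sA // (perm_mem ps) mem_enum.
Qed.

End Polarization.

Section Multilinear.
Variables (U : eqType) (S : pzRingType) (f : U -> S).
Local Notation val u := (\prod_(c <- u) f c).

(** When the brackets are expanded, [val s * v] is the only term with [v] in last place. *)
Lemma foldr_lie_span (s : seq U) (v : S) (G : S -> Prop) : subgroup G ->
  (forall p q, perm_eq (p ++ q) s -> q != [::] -> G (val p * v * val q)) ->
  G (foldr (fun i => lie (f i)) v s - val s * v).
Proof.
elim: s G => [|c s IH] G sG hG /=; first by rewrite big_nil mul1r subrr; case: sG.
set w := foldr _ _ _ in IH *.
have -> : lie (f c) w - val (c :: s) * v =
    f c * (w - val s * v) - ((w - val s * v) * f c + val s * v * f c).
  rewrite big_cons /lie mulrBr mulrBl subrK !mulrA.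
  by rewrite addrAC.
apply: (sG.2).
  have := IH _ (subgroup_mul (f c) 1 sG); rewrite mulr1; apply=> p q pq q0.
  have -> : f c * (val p * v * val q) * 1 = val (c :: p) * v * val q.
    by rewrite big_cons mulr1 !mulrA.
  by apply: hG; rewrite //= perm_cons.
apply: subgroupD => //.
  have := IH _ (subgroup_mul 1 (f c) sG); rewrite mul1r; apply=> p q pq q0.
  have -> : 1 * (val p * v * val q) * f c = val p * v * val (q ++ [:: c]).
    by rewrite big_cat big_seq1 mul1r mulrA.
  apply: hG; last by case: (q).
  by rewrite catA perm_catC perm_cons.
have <- : val [:: c] = f c by rewrite big_seq1.
by apply: hG; rewrite // perm_catC.
Qed.

(** The last letter [x] of [us] is the argument and the other [e] letters are the polarized
    variables. Each iterated bracket has exactly one word ending in [x], so [us] occurs once, with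
    coefficient 1. *)
Theorem engel_multilinear e (us : seq U) (G : S -> Prop) :
  engel e S -> subgroup G -> uniq us -> size us = e.+1 ->
  (forall us', perm_eq us' us -> us' != us -> G (val us')) -> G (val us).
Proof.
move=> engS sG; case/lastP: us => // ys x; rewrite size_rcons => uus [sys] hG.
pose t := tcast sys (in_tuple ys).
have et : ys = t by rewrite val_tcast.
have H := polarization (fun i => f (tnth t i)) (f x) engS.
rewrite -big_filter (bigD1_seq (enum 'I_e)) /= in H; first last.
- by rewrite filter_uniq // words_uniq // enum_uniq.
- by rewrite mem_filter perm_refl mem_words size_enum_ord eqxx; apply/allP => i; rewrite mem_enum.
have adsE s : ads (fun i => f (tnth t i)) s (f x) =
    foldr (fun i => lie (f i)) (f x) (map (tnth t) s).
  by rewrite foldr_map.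
have spanG s : perm_eq (map (tnth t) s) ys ->
    G (ads (fun i => f (tnth t i)) s (f x) - val (rcons (map (tnth t) s) x)).
  move=> ps; rewrite adsE -cats1 big_cat big_seq1.
  apply: foldr_lie_span => // p q pq q0.
  have -> : val p * f x * val q = val (p ++ x :: q) by rewrite big_cat big_cons /= mulrA.
  apply: hG.
    by rewrite (perm_catCA p [:: x] q) /= perm_sym perm_rcons perm_cons perm_sym (perm_trans pq).
  case/lastP: q q0 pq => // q c _ pq; apply: contraTneq uus.
  rewrite -rcons_cons -rcons_cat => /rcons_inj[e1 e2].
  by rewrite rcons_uniq -(perm_mem ps) -(perm_mem pq) mem_cat mem_rcons e2 mem_head orbT.
have tE : map (tnth t) (enum 'I_e) = ys by rewrite [RHS]et map_tnth_enum.
rewrite -[val _]subr0 -H opprD addrA; apply: (sG.2).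
  by rewrite -opprB; apply: subgroupN => //; have := spanG (enum 'I_e); rewrite tE; apply.
apply: subgroup_sum => // s; rewrite mem_filter => /andP[ps _] s_ne.
have ps' : perm_eq (map (tnth t) s) ys by rewrite -tE perm_map.
rewrite -[ads _ _ _](subrK (val (rcons (map (tnth t) s) x))).
apply: subgroupD => //; first exact: spanG.
apply: hG; first by rewrite -!cats1 perm_cat2r.
rewrite eqseq_rcons eqxx andbT; apply: contra s_ne => /eqP es; apply/eqP.
apply: (inj_map (f := tnth t)); last by rewrite tE.
have : uniq t by rewrite -et; move: uus; rewrite rcons_uniq => /andP[].
by move/tuple_uniqP.
Qed.
End Multilinear.

(** * Nilpotency of [a, b] r in Engel rings *)

From mathcomp Require Import classical_sets.

(** * Quotients by two-sided ideals *)

Record twosided_ideal (S : pzRingType) := TwosidedIdeal {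
  in_ideal :> S -> Prop;
  ideal0 : in_ideal 0;
  idealB : forall x y, in_ideal x -> in_ideal y -> in_ideal (x - y);
  idealMl : forall r x, in_ideal x -> in_ideal (r * x);
  idealMr : forall r x, in_ideal x -> in_ideal (x * r) }.

Definition ideal_pred (S : pzRingType) (I : twosided_ideal S) : {pred S} :=
  fun x => `[< I x >].

Fact ideal_pred_zmod_closed (S : pzRingType) (I : twosided_ideal S) :
  zmod_closed (ideal_pred I).
Proof.
split=> [|x y /asboolP Ix /asboolP Iy]; apply/asboolP; first exact: ideal0.
exact: idealB.
Qed.
HB.instance Definition _ (S : pzRingType) (I : twosided_ideal S) :=
  GRing.isZmodClosed.Build S (ideal_pred I) (ideal_pred_zmod_closed I).

Definition quot_ring (S : pzRingType) (I : twosided_ideal S) :=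
  Quotient.quot (ideal_pred I : zmodClosed S).
HB.instance Definition _ (S : pzRingType) (I : twosided_ideal S) :=
  GRing.Zmodule.copy (quot_ring I)
    (Quotient.quot (ideal_pred I : zmodClosed S)).

Section IdealQuotient.
Local Open Scope quotient_scope.
Variables (S : pzRingType) (I : twosided_ideal S).
Local Notation Q := (Quotient.quot (ideal_pred I : zmodClosed S)).

Definition quot_mul : Q -> Q -> Q := lift_op2 Q *%R.
Definition quot_one : Q := \pi_Q 1.

Lemma pi_quot_mul : {morph \pi_Q : x y / x * y >-> quot_mul x y}.
Proof.
move=> x y; unlock quot_mul; apply/eqP; rewrite piE Quotient.equivE.
have hr z : I (z - repr (\pi_Q z)).
  have : z - repr (\pi_Q z) \in ideal_pred I.
    by rewrite (Quotient.idealrBE (ideal_pred I)) reprK.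
  by move/asboolP.
rewrite -[_ * _](addrNK (x * repr (\pi_Q y))) -mulrBr -addrA -mulrBl.
by rewrite rpredD //; apply/asboolP; [apply: idealMl | apply: idealMr].
Qed.
Canonical pi_quot_mul_morph := PiMorph2 pi_quot_mul.
Lemma quot_mulA : associative quot_mul.
Proof. by move=> x y z; rewrite -[x]reprK -[y]reprK -[z]reprK !piE mulrA. Qed.

Lemma quot_mul1 : left_id quot_one quot_mul.
Proof. by move=> x; rewrite -[x]reprK /quot_one !piE mul1r. Qed.

Lemma quot_mulr1 : right_id quot_one quot_mul.
Proof. by move=> x; rewrite -[x]reprK /quot_one !piE mulr1. Qed.

Lemma quot_mulDl : left_distributive quot_mul +%R.
Proof. by move=> x y z; rewrite -[x]reprK -[y]reprK -[z]reprK !piE mulrDl. Qed.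

Lemma quot_mulDr : right_distributive quot_mul +%R.
Proof. by move=> x y z; rewrite -[x]reprK -[y]reprK -[z]reprK !piE mulrDr. Qed.

HB.instance Definition _ := GRing.Zmodule_isPzRing.Build (quot_ring I)
  quot_mulA quot_mul1 quot_mulr1 quot_mulDl quot_mulDr.

End IdealQuotient.

Section QuotientLie.
Local Open Scope quotient_scope.
Variables (S : pzRingType) (I : twosided_ideal S).

Definition in_quot (x : S) : quot_ring I := \pi_(quot_ring I) x.

Lemma in_quot_eq0 x : in_quot x = 0 <-> I x.
Proof.
have -> : (0 : quot_ring I) = in_quot 0 by rewrite /in_quot piE.
split=> [/eqP|Ix]; first by rewrite -Quotient.idealrBE subr0 => /asboolP.
by apply/eqP; rewrite -Quotient.idealrBE subr0; apply/asboolP.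
Qed.

Lemma in_quot_surj (x : quot_ring I) : exists y, x = in_quot y.
Proof. by exists (repr x); rewrite /in_quot reprK. Qed.

Lemma in_quotM x y : in_quot (x * y) = in_quot x * in_quot y.
Proof. exact: pi_quot_mul. Qed.

Lemma in_quotB x y : in_quot (x - y) = in_quot x - in_quot y.
Proof. by rewrite /in_quot !piE. Qed.

Lemma in_quot_lie x y : in_quot (lie x y) = lie (in_quot x) (in_quot y).
Proof. by rewrite /lie in_quotB !in_quotM. Qed.

Lemma engel_quot e : engel e S -> engel e (quot_ring I).
Proof.
move=> engS y x; have [y0 ->] := in_quot_surj y; have [x0 ->] := in_quot_surj x.
have -> i : iter i (lie (in_quot y0)) (in_quot x0) = in_quot (iter i (lie y0) x0).
  by elim: i => [//|i IH]; rewrite !iterS IH in_quot_lie.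
by rewrite engS; apply/in_quot_eq0/ideal0.
Qed.

End QuotientLie.

(** * A prime ideal avoiding the powers of an element *)

Local Open Scope classical_set_scope.

(* [set0] is allowed so that the empty chain has a bound. *)
Definition power_avoiding (S : pzRingType) (t : S) (A : set S) :=
  [/\ forall x y, A x -> A y -> A (x - y),
      forall r x, A x -> A (r * x) /\ A (x * r) & forall k, ~ A (t ^+ k)].

(** Zorn's lemma gives an ideal [A] maximal among those without powers of [t]. Larger ideals contain
    powers of [t], so x S y inside [A] with [x], [y] outside would put some t^(k+l) into [A]. *)
Lemma ex_prime_avoiding (S : pzRingType) (t : S) : (forall k, t ^+ k <> 0) ->
  exists I : twosided_ideal S, prime_ring (quot_ring I) /\ ~ I t.
Proof.
move=> tn0.
have [|A [[AB AM At] Amax]] := @Zorn_bigcup S (power_avoiding t).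
  move=> F FP Ftot; split.
  - move=> x y [X FX Xx] [Y FY Yy].
    have [XY|YX] := Ftot X Y FX FY.
      by exists Y => //; case: (FP Y FY) => YB _ _; apply: YB => //; apply: XY.
    by exists X => //; case: (FP X FX) => XB _ _; apply: XB => //; apply: YX.
  - by move=> r x [X FX Xx]; case: (FP X FX) => _ /(_ r x Xx)[? ?] _; split; exists X.
  - by move=> k [X FX]; case: (FP X FX) => _ _ /(_ k).
(* The maximal element is not empty, since [[set 0]] would be larger. *)
have A0 : A 0.
  have [[x Ax]|nA] := pselect (A !=set0); first by rewrite -(subrr x); apply: (AB).
  have [] := Amax [set 0].
    split; first by move=> x Ax; case: nA; exists x.
    by move=> h; apply: nA; exists 0; apply: h.
  split=> [x y -> ->|r x ->|k /tn0//]; first by rewrite subr0.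
  by rewrite mulr0 mul0r.
pose I := @TwosidedIdeal S A A0 AB (fun r x Ax => (AM r x Ax).1) (fun r x Ax => (AM r x Ax).2).
exists I; split; last exact: (At 1%N).
have AD x y : A x -> A y -> A (x + y).
  by move=> Ax Ay; rewrite -[y]opprK -[- y]sub0r; apply: (AB) => //; apply: (AB).
have big x : ~ A x -> exists k, forall C : set S, C x -> A `<=` C ->
    (forall u v, C u -> C v -> C (u - v)) ->
    (forall r u, C u -> C (r * u) /\ C (u * r)) -> C (t ^+ k).
  move=> nAx; apply: contrapT => H.
  (* The ideal generated by [A] and [x], as an intersection. *)
  pose B : set S := fun s => forall C : set S, C x -> A `<=` C ->
    (forall u v, C u -> C v -> C (u - v)) ->
    (forall r u, C u -> C (r * u) /\ C (u * r)) -> C s.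
  have [] := Amax B.
    split; first by move=> a Aa C _ subC _ _; apply: subC.
    by move=> BA; apply: nAx; apply: BA => C.
  split=> [u v Bu Bv C Cx subC CB CM|r u Bu|k Bk]; last by apply: H; exists k.
    by apply: (CB); [apply: Bu | apply: Bv].
  by split=> C Cx subC CB CM; have [] := CM r u (Bu C Cx subC CB CM).
move=> x0 y0; have [x ->] := in_quot_surj x0; have [y ->] := in_quot_surj y0.
move=> xry; apply: contrapT => /not_orP[x_nin y_nin].
have [k Hk] := big x (fun Ax => x_nin ((in_quot_eq0 I x).2 Ax)).
have [l Hl] := big y (fun Ay => y_nin ((in_quot_eq0 I y).2 Ay)).
(* In x S y, first [x] and then [y] is replaced by a power of [t]: the admissible replacements form
   an ideal containing [A]. *)
have A1 r : A (t ^+ k * r * y).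
  apply: (Hk (fun u => forall r, A (u * r * y))) => {r}.
  - by move=> r; apply/(in_quot_eq0 I); rewrite !in_quotM.
  - by move=> a Aa r; apply: (AM _ _ _).2; apply: (AM _ _ _).2.
  - by move=> u v hu hv r; rewrite !mulrBl; apply: (AB).
  - move=> r u hu; split=> r'; last by rewrite -(mulrA u).
    by rewrite -!mulrA; apply: (AM _ _ _).1; rewrite mulrA.
apply: (At (k + l)%N); rewrite exprD -[t ^+ k]mulr1.
apply: (Hl (fun v => forall r, A (t ^+ k * r * v))) => //.
- by move=> a Aa r; apply: (AM _ _ _).1.
- by move=> u v hu hv r; rewrite !mulrBr; apply: (AB).
- move=> r u hu; split=> r'; first by rewrite mulrA -(mulrA _ r').
  by rewrite mulrA; apply: (AM _ _ _).2.
Qed.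

(** Otherwise the element survives in a prime quotient, which is an Engel domain and so commutative,
    although [a, b] is zero there. *)
Theorem engel_lie_nil e (S : pzRingType) (a b r : S) : engel e S ->
  exists k, (lie a b * r) ^+ k = 0.
Proof.
move=> engS; apply: contrapT => H.
have [k h|I [primeI]] := @ex_prime_avoiding S (lie a b * r); first by apply: H; exists k.
apply; apply/in_quot_eq0; rewrite in_quotM in_quot_lie.
have engQ := @engel_quot _ I _ engS.
by rewrite (engel_domain (engel_prime_domain primeI engQ) engQ) mul0r.
Qed.

(** * Countable products of rings *)

Section ProductRing.
Variable S : nat -> pzRingType.

Definition seq_ring := forall k, S k.
HB.instance Definition _ := gen_eqMixin seq_ring.
HB.instance Definition _ := gen_choiceMixin seq_ring.

Implicit Types x y z : seq_ring.
Let add x y : seq_ring := fun k => x k + y k.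
Let opp x : seq_ring := fun k => - x k.
Let mul x y : seq_ring := fun k => x k * y k.
Let zero : seq_ring := fun k => 0.
Let one : seq_ring := fun k => 1.

Fact seq_addA : associative add.
Proof. by move=> x y z; apply: functional_extensionality_dep => k; apply: addrA. Qed.
Fact seq_addC : commutative add.
Proof. by move=> x y; apply: functional_extensionality_dep => k; apply: addrC. Qed.
Fact seq_add0 : left_id zero add.
Proof. by move=> x; apply: functional_extensionality_dep => k; apply: add0r. Qed.
Fact seq_addN : left_inverse zero opp add.
Proof. by move=> x; apply: functional_extensionality_dep => k; apply: addNr. Qed.
HB.instance Definition _ :=
  GRing.isZmodule.Build seq_ring seq_addA seq_addC seq_add0 seq_addN.

Fact seq_mulA : associative mul.
Proof. by move=> x y z; apply: functional_extensionality_dep => k; apply: mulrA. Qed.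
Fact seq_mul1 : left_id one mul.
Proof. by move=> x; apply: functional_extensionality_dep => k; apply: mul1r. Qed.
Fact seq_mulr1 : right_id one mul.
Proof. by move=> x; apply: functional_extensionality_dep => k; apply: mulr1. Qed.
Fact seq_mulDl : left_distributive mul add.
Proof. by move=> x y z; apply: functional_extensionality_dep => k; apply: mulrDl. Qed.
Fact seq_mulDr : right_distributive mul add.
Proof. by move=> x y z; apply: functional_extensionality_dep => k; apply: mulrDr. Qed.
HB.instance Definition _ := GRing.Zmodule_isPzRing.Build seq_ring
  seq_mulA seq_mul1 seq_mulr1 seq_mulDl seq_mulDr.

Lemma engel_seq_ring e : (forall k, engel e (S k)) -> engel e seq_ring.
Proof.
move=> engS y x; apply: functional_extensionality_dep => k.
have -> i : iter i (lie y) x k = iter i (lie (y k)) (x k).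
  by elim: i => [//|i IH]; rewrite !iterS -IH.
exact: engS.
Qed.

Lemma seq_ring_exp x n k : (x ^+ n) k = x k ^+ n.
Proof. by elim: n => [//|n IH]; rewrite !exprS -IH. Qed.

End ProductRing.

(** Counterexamples for all exponents, put together as components, would form a non-nilpotent
    element [a, b] r of one Engel ring. *)
Theorem engel_lie_nil_uniform e : exists k, forall (S : pzRingType) (a b r : S),
  engel e S -> (lie a b * r) ^+ k = 0.
Proof.
apply: contrapT => /forallNP H.
have {}H k : exists S : pzRingType, exists abr : S * S * S,
    engel e S /\ (lie abr.1.1 abr.1.2 * abr.2) ^+ k <> 0.
  apply: contrapT => H'; apply: (H k) => S a b r engS; apply: contrapT => nz.
  by apply: H'; exists S, (a, b, r).
pose S k := sval (cid (H k)); pose abr k := sval (cid (svalP (cid (H k)))).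
have habr k := svalP (cid (svalP (cid (H k)))).
have engS : engel e (seq_ring S).
  by apply: engel_seq_ring => k; case: (habr k).
pose a : seq_ring S := fun k => (abr k).1.1.
pose b : seq_ring S := fun k => (abr k).1.2.
pose r : seq_ring S := fun k => (abr k).2.
have [n /(congr1 (fun x : seq_ring S => x n))] := engel_lie_nil a b r engS.
by rewrite seq_ring_exp; case: (habr n).
Qed.

(** * Nilpotency of the commutator ideal *)

Definition wordval (T : Type) (S : pzRingType) (f : T -> S) (w : seq T) : S :=
  \prod_(c <- w) f c.

Lemma wordval_cat T (S : pzRingType) (f : T -> S) u v :
  wordval f (u ++ v) = wordval f u * wordval f v.
Proof. by rewrite /wordval big_cat. Qed.

Lemma wordval_power T (S : pzRingType) (f : T -> S) k v :
  wordval f (flatten (nseq k v)) = wordval f v ^+ k.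
Proof.
elim: k => [|k IH]; first by rewrite /wordval big_nil.
by rewrite [flatten _]/(v ++ flatten (nseq k v)) wordval_cat IH exprS.
Qed.

Lemma ltlexi_cat2r disp (T : orderType disp) (u v s : seq T) :
  size u = size v -> ((u : seqlexi T) < v)%O ->
  ((u ++ s : seqlexi T) < v ++ s)%O.
Proof.
move=> esz /ltlexi_split[[c [z ev]]|//].
by move: esz; rewrite ev size_cat /= -addSnnS -[LHS]addn0 => /eqP; rewrite eqn_leq; lia.
Qed.

Lemma ltn_count (T : Type) (P1 P2 : pred T) s : subpred P1 P2 ->
  has (fun x => P2 x && ~~ P1 x) s -> (count P1 s < count P2 s)%N.
Proof.
move=> h; elim: s => //= x s IH /orP[/andP[p2 np1]|/IH lt].
  by rewrite (negbTE np1) p2 ltnS sub_count.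
by rewrite -addnS leq_add //; case: (P1 x) (h x) => // ->.
Qed.

(** Descent on the number of words of length [n] over [A] below [w]: [engel_multilinear] replaces a
    divisible word by smaller rearrangements. *)
Lemma indivisible_span e disp (T : orderType disp) (A : seq T) (S : pzRingType)
    (f : T -> S) (G : S -> Prop) n : engel e S -> subgroup G ->
  (forall w, {subset w <= A} -> size w = n -> ~ has_divided e.+1 w ->
    G (wordval f w)) ->
  forall w, {subset w <= A} -> size w = n -> G (wordval f w).
Proof.
move=> engS sG hG w.
have [k] := ubnP (count (fun w' : seqlexi T => w' < w)%O (words A n)).
elim: k w => // k IH w; rewrite ltnS => wk wA sw.
have [[p [us [s [sus [Uus _ dus] ew]]]]|] := pselect (has_divided e.+1 w); last exact: hG.
pose G' z := G (wordval f p * z * wordval f s).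
have sG' : subgroup G' by apply: subgroup_mul.
have : G' (\prod_(u <- us) wordval f u).
  apply: (engel_multilinear engS sG' Uus sus) => us' pus nus.
  have lt_flat := dus us' pus nus.
  have sz_flat : size (flatten us') = size (flatten us).
    by apply/perm_size/perm_flatten.
  have -> : \prod_(u <- us') wordval f u = wordval f (flatten us').
    by rewrite /wordval big_flatten.
  rewrite /G' -!wordval_cat.
  have w'w : ((p ++ flatten us' ++ s : seqlexi T) < w)%O.
    by rewrite ew ltlexi_cat2l ltlexi_cat2r.
  have w'A : {subset (p ++ flatten us') ++ s <= A}.
    move=> c; rewrite !mem_cat (perm_mem (perm_flatten pus)) => h.
    by apply: wA; rewrite ew !mem_cat orbA.
  have sw' : size ((p ++ flatten us') ++ s) = n.
    by rewrite -sw ew !size_cat sz_flat addnA.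
  apply: IH => //; apply: leq_trans wk.
  apply: ltn_count => [v /= h|]; first by rewrite (lt_trans h) // -catA.
  apply/hasP; exists ((p ++ flatten us') ++ s); last by rewrite /= ltxx -catA w'w.
  by rewrite mem_words sw' eqxx; apply/allP.
rewrite /G'; have -> : \prod_(u <- us) wordval f u = wordval f (flatten us).
  by rewrite /wordval big_flatten.
by rewrite -!wordval_cat -catA ew.
Qed.

(** Generation over the centre, as an induction principle for left multiplication. Central
    coefficients take the place of scalars, so no base ring has to be mentioned. *)
Definition center_generated (d : nat) (S : pzRingType) (g : 'I_d -> S) :=
  forall P : S -> Prop, subgroup P -> P 1 ->
  (forall z x, (forall y, z * y = y * z) -> P x -> P (z * x)) ->
  (forall i x, P x -> P (g i * x)) -> forall x, P x.

Definition right_ideal (S : pzRingType) (G : S -> Prop) :=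
  subgroup G /\ forall x r, G x -> G (x * r).

Section Generated.
Variables (d e : nat) (S : pzRingType) (g : 'I_d -> S).
Hypotheses (engS : engel e S) (genS : center_generated g).

(** Central factors are moved to the far right, where the right ideal absorbs them. *)
Lemma words_mul_ideal (G : S -> Prop) x : right_ideal G ->
  (forall w : seq 'I_d, G (wordval g w * x)) -> forall s, G (s * x).
Proof.
move=> [sG rG] Gw s.
suff : forall w, G (wordval g w * s * x).
  by move/(_ [::]); rewrite /wordval big_nil mul1r.
apply: (genS (P := fun s => forall w, G (wordval g w * s * x))).
- split=> [w|s1 s2 h1 h2 w]; first by rewrite mulr0 mul0r; case: sG.
  by rewrite mulrBr mulrBl; apply: (sG.2).
- by move=> w; rewrite mulr1.
- by move=> z s1 cz h w; rewrite mulrA -cz -mulrA -mulrA cz; apply: rG; rewrite mulrA.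
- move=> i s1 h w; have := h (rcons w i).
  by rewrite -cats1 wordval_cat {2}/wordval big_seq1 !mulrA.
Qed.

(** Induction on the length. A long indivisible word contains some v^e, and the Engel identity moves
    copies of [v] to the right of [x], where [G] absorbs them; a shorter word remains on the
    left. *)
Lemma short_words_mul_ideal L (G : S -> Prop) x :
  (forall w : seq 'I_d, (L <= size w)%N -> has_power e w \/ has_divided e.+1 w) ->
  right_ideal G ->
  (forall w : seq 'I_d, (size w < L)%N -> G (wordval g w * x)) ->
  forall s, G (s * x).
Proof.
move=> hL rG Gw; apply: words_mul_ideal => //.
have [sG GM] := rG.
move=> w; have [n] := ubnP (size w); elim: n w => // n IH w; rewrite ltnS => wn.
have [Lw|] := leqP L (size w); last exact: Gw.
have sGx : subgroup (fun z => G (1 * z * x)).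
  by split=> [|y z]; rewrite ?mulr0 ?mul0r ?mul1r ?mulrBr ?mulrBl ?mul1r; [case: sG|apply: (sG.2)].
rewrite -[wordval g w]mul1r.
apply: (indivisible_span (A := enum 'I_d) (n := size w) engS sGx) => //;
  last by move=> u _; rewrite mem_enum.
move=> u uA su ndiv.
have [|[p [v [s [v0 eu]]]]|//] := hL u; first by rewrite su.
have := iter_lie (wordval g v) e (wordval g s * x).
rewrite engS big_ord_recl /= subn0 !expr0 mul1r mulr1 bin0 mulr1n => /esym/addr0_eq E1.
rewrite mul1r eu !wordval_cat wordval_power -!mulrA.
rewrite -[_ ^+ e * _]opprK E1 mulrN; apply: subgroupN => //.
rewrite mulr_sumr; apply: subgroup_sum => // i _ _.
set l := lift ord0 i.
have -> : wordval g p * ((-1) ^+ l * (wordval g v ^+ (e - l) * (wordval g s * x) *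
     wordval g v ^+ l) *+ 'C(e, l)) =
   wordval g (p ++ flatten (nseq (e - l) v) ++ s) * x *
     (wordval g v ^+ l * (-1) ^+ l * ('C(e, l)%:R)).
  have csgn y : (-1) ^+ l * y = y * (-1) ^+ l by rewrite -commr_sign.
  by rewrite csgn !wordval_cat wordval_power -mulr_natr !mulrA.
apply: GM; apply: IH; apply: leq_trans wn; rewrite -su eu !size_cat.
rewrite ltn_add2l ltn_add2r.
have szp k : size (flatten (nseq k v)) = (k * size v)%N.
  by elim: k => //= k IHk; rewrite size_cat IHk mulSn.
rewrite !szp ltn_mul2r lt0n size_eq0 v0 /l /= /bump /=.
have := ltn_ord i; lia.
Qed.

Definition commutators : seq S := [seq lie (g i) (g j) | i <- enum 'I_d, j <- enum 'I_d].

(** The powers of the ideal J generated by the commutators of the generators: sums of products r1 c1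
    r2 c2 ... rn cn r. *)
Fixpoint comm_power n : S -> Prop :=
  if n is n'.+1 then fun x => forall G : S -> Prop, subgroup G ->
    (forall r c z, c \in commutators -> comm_power n' z -> G (r * c * z)) -> G x
  else fun=> True.

Lemma comm_power_subgroup n : subgroup (comm_power n).
Proof.
case: n => [|n] //=; split=> [G sG _|x y hx hy G sG hG]; first by case: sG.
by apply: (sG.2); [apply: hx | apply: hy].
Qed.

Lemma comm_power_mulr n x r : comm_power n x -> comm_power n (x * r).
Proof.
elim: n x => [|n IH] //= x hx G sG hG.
have := hx _ (subgroup_mul 1 r sG); rewrite mul1r; apply=> r' c z cc hz.
by rewrite mul1r -mulrA; apply: hG => //; apply: IH.
Qed.

Lemma comm_power_mull n r x : comm_power n x -> comm_power n (r * x).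
Proof.
case: n => [|n] //= hx G sG hG.
have := hx _ (subgroup_mul r 1 sG); rewrite mulr1; apply=> r' c z cc hz.
by rewrite mulr1 !mulrA; apply: hG.
Qed.

(** For fixed [c], the z with all r c z in [G] form a right ideal, to which the induction hypothesis
    applies; the outer r is then reduced to short words. *)
Lemma comm_power_span L n (G : S -> Prop) :
  (forall w : seq 'I_d, (L <= size w)%N -> has_power e w \/ has_divided e.+1 w) ->
  right_ideal G ->
  (forall us : seq (seq 'I_d * S),
     all (fun u => (size u.1 < L)%N && (u.2 \in commutators)) us -> size us = n ->
     G (wordval (fun u => wordval g u.1 * u.2) us)) ->
  forall z, comm_power n z -> G z.
Proof.
move=> hL; elim: n G => [|n IH] G [sG rG] hG z /=.
  move=> _; have := rG _ z (hG [::] isT erefl).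
  by rewrite /wordval big_nil mul1r.
apply=> // r c z' cc; have crG : right_ideal (fun z => forall r, G (r * c * z)).
  split=> [|x y hx r']; last by rewrite mulrA; apply: rG.
  split=> [r'|x y hx hy r']; first by rewrite mulr0; case: sG.
  by rewrite mulrBr; apply: (sG.2).
move/(IH _ crG); apply=> us hus sus r'; rewrite -mulrA.
apply: (short_words_mul_ideal hL) => // w wL.
have := hG ((w, c) :: us); rewrite /wordval big_cons /= mulrA; apply; last by rewrite sus.
by rewrite wL cc.
Qed.

End Generated.

Lemma mem_commutators_lie d (S : pzRingType) (g : 'I_d -> S) c :
  c \in commutators g -> exists a b, c = lie a b.
Proof. by case/allpairsP => [[i j] [_ _ ->]]; exists (g i), (g j). Qed.

(** Cyclic shift: (b c x)^n b = b (c x b)^n. *)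
Lemma power_lie_word_eq0 k (S : pzRingType) (b c x : S) :
  (forall r, (c * r) ^+ k = 0) -> (b * c * x) ^+ k.+1 = 0.
Proof.
move=> nilc.
have E n : (b * c * x) ^+ n * b = b * (c * (x * b)) ^+ n.
  elim: n => [|n IH]; first by rewrite mul1r mulr1.
  have -> : (b * c * x) ^+ n.+1 * b = (b * c * x) ^+ n * b * (c * (x * b)).
    by rewrite exprSr !mulrA.
  by rewrite IH exprSr [RHS]mulrA.
have -> : (b * c * x) ^+ k.+1 = (b * c * x) ^+ k * b * (c * x).
  by rewrite exprSr !mulrA.
by rewrite E nilc mulr0 mul0r.
Qed.

(** Shirshov's theorem is used for words in the generators and again for words in the letters b c,
    with b a short word. The number of these letters depends on [d] and [e] only, and high powers of
    words in them vanish. *)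
Theorem comm_power_nilpotent d e : exists N,
  forall (S : pzRingType) (g : 'I_d -> S), engel e S -> center_generated g ->
  forall z, comm_power g N z -> z = 0.
Proof.
have [k0 nil0] := engel_lie_nil_uniform e.
have [L hL] := shirshov e e.+1 d.
have [N hN] := shirshov k0.+1 e.+1 (size (words_upto (enum 'I_d) L) * (d * d)).
exists N => S g engS genS; apply: (comm_power_span engS genS (L := L)) => //.
- by move=> w Lw; apply: (hL _ _ (enum 'I_d)); rewrite ?size_enum_ord // => c _; rewrite mem_enum.
- split; first by split=> // x y -> ->; rewrite subr0.
  by move=> x r ->; rewrite mul0r.
move=> us hus sus.
pose letters := [seq (w, c) | w <- words_upto (enum 'I_d) L, c <- commutators g].
have us_letters : {subset us <= letters}.
  move=> [w c] /(allP hus) /= /andP[wL cc]; apply/allpairsP; exists (w, c); split=> //=.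
  by apply: mem_words_upto (ltnW wL) => i _; rewrite mem_enum.
(* Letters are replaced by their indices to obtain an ordered alphabet. *)
pose f i := let u := nth ([::], 0) letters i in wordval g u.1 * u.2.
have -> : wordval (fun u => wordval g u.1 * u.2) us = wordval f (map (index^~ letters) us).
  rewrite /wordval big_map; apply: eq_big_seq => u uu.
  by rewrite /f nth_index // us_letters.
apply: (@indivisible_span e _ nat (iota 0 (size letters)) S f (fun z => z = 0) N) => //.
- by split=> // x y -> ->; rewrite subr0.
- move=> w wA sw ndiv.
  have [|//||[p [v [s [v0 ew]]]]|//] := hN _ nat (iota 0 (size letters)) w.
  + by rewrite size_iota !size_allpairs size_enum_ord.
  + by rewrite sw.
  rewrite ew !wordval_cat wordval_power -exprS.
  have -> : wordval f v ^+ k0.+1 = 0.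
    case: v v0 ew => // i v _ ew; rewrite /wordval big_cons.
    apply: power_lie_word_eq0 => r.
    have : nth ([::], 0) letters i \in letters.
      apply: mem_nth; have := wA i; rewrite ew !mem_cat mem_head orbT mem_iota.
      by move=> /(_ isT).
    case/allpairsP => -[w1 c] /= [_ /mem_commutators_lie[a [b ->]] ->] /=.
    exact: nil0.
  by rewrite mul0r mulr0.
- by move=> i /mapP[u /us_letters uu ->]; rewrite mem_iota /= add0n index_mem.
- by rewrite size_map.
Qed.

(** * The series gamma *)

Arguments comm_power : simpl never.

Definition ring_ideal (S : pzRingType) (I : S -> Prop) :=
  subgroup I /\ forall x r, I x -> I (x * r) /\ I (r * x).

Fixpoint ring_gam (S : pzRingType) (m : nat) : S -> Prop :=
  if m is m'.+1 then fun x => forall I : S -> Prop, ring_ideal I ->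
    (forall a r, ring_gam m' a -> I (lie a r)) -> I x
  else fun=> True.

Lemma size_sum_count (T : finType) (w : seq T) :
  size w = \sum_(a : T) count_mem a w.
Proof.
elim: w => [|b w IH] /=; first by rewrite big1.
rewrite big_split /= -IH (bigD1 b) //= eqxx big1 // => a /negbTE.
by rewrite eq_sym => ->.
Qed.

Section GammaPower.
Variables (d e : nat) (S : pzRingType) (g : 'I_d -> S).
Hypotheses (engS : engel e S) (genS : center_generated g).
Local Notation J := (comm_power g).

Definition gads (w : seq 'I_d) z := foldr (fun i => lie (g i)) z w.

Lemma comm_power_ideal n : ring_ideal (J n).
Proof.
split=> [|x r Jx]; first exact: comm_power_subgroup.
by split; [apply: comm_power_mulr | apply: comm_power_mull].
Qed.

Lemma comm_powerB n x y : J n x -> J n y -> J n (x - y).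
Proof. exact: (comm_power_ideal n).1.2. Qed.

Lemma comm_power_lie n x r : J n x -> J n (lie r x).
Proof.
by move=> Jx; apply: comm_powerB; [apply: comm_power_mull|apply: comm_power_mulr].
Qed.

Lemma comm_power_gads n w z : J n z -> J n (gads w z).
Proof. by move=> Jz; elim: w => //= i w; apply: comm_power_lie. Qed.

Lemma comm_powerSl n i j x : J n x -> J n.+1 (lie (g i) (g j) * x).
Proof.
move=> Jx G sG hG; rewrite -[lie _ _]mul1r; apply: hG => //.
by apply/allpairsP; exists (i, j); rewrite !mem_enum.
Qed.

(** The recursion adds commutators on the left, so the factor on the right is reached by
    induction. *)
Lemma comm_powerSr n i j x : J n x -> J n.+1 (x * lie (g i) (g j)).
Proof.
elim: n x => [|n IH] x Jx.
  by rewrite -[lie _ _]mulr1; apply: comm_power_mull; apply: comm_powerSl.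
apply: (Jx (fun x => J n.+2 (x * lie (g i) (g j)))).
  exact: subgroup_mulr (comm_power_subgroup g n.+2).
by move=> r c z cc Jz; rewrite -mulrA => G sG hG; apply: hG => //; apply: IH.
Qed.

Lemma comm_powerD n x y : J n x -> J n y -> J n (x + y).
Proof. exact: subgroupD (comm_power_subgroup g n). Qed.

(** Each exchange of a bracket with the factor [g i] costs a multiple of some [g j, g i], which
    raises the power of J. *)
Lemma gads_mull n w i z : J n z -> J n.+1 (gads w (g i * z) - g i * gads w z).
Proof.
move=> Jz; elim: w => [|j w IH] /=; first by rewrite subrr; case: (comm_power_subgroup g n.+1).
have -> : lie (g j) (gads w (g i * z)) - g i * lie (g j) (gads w z) =
    lie (g j) (gads w (g i * z) - g i * gads w z) + lie (g j) (g i) * gads w z.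
  by rewrite raddfB /= [lie _ (g i * _)]lie_mul opprD addrA addrAC subrK.
apply: comm_powerD; first exact: comm_power_lie.
by apply: comm_powerSl; apply: comm_power_gads.
Qed.

Lemma gads_mulr n w i z : J n z -> J n.+1 (gads w (z * g i) - gads w z * g i).
Proof.
move=> Jz; elim: w => [|j w IH] /=; first by rewrite subrr; case: (comm_power_subgroup g n.+1).
have -> : lie (g j) (gads w (z * g i)) - lie (g j) (gads w z) * g i =
    lie (g j) (gads w (z * g i) - gads w z * g i) + gads w z * lie (g j) (g i).
  by rewrite raddfB /= [lie _ (_ * g i)]lie_mul opprD addrA subrK.
apply: comm_powerD; first exact: comm_power_lie.
by apply: comm_powerSr; apply: comm_power_gads.
Qed.

Lemma gads_central w z x : (forall y, z * y = y * z) ->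
  gads w (z * x) = z * gads w x.
Proof.
move=> cz; elim: w => //= i w ->; rewrite lie_mul.
by rewrite {1}/lie -cz subrr mul0r add0r.
Qed.

(** A filtration between J^n and J^(n+1): the j-fold brackets of J^n with generators, together with
    J^(n+1). *)
Definition layer n j x := forall G : S -> Prop, subgroup G ->
  (forall z, J n.+1 z -> G z) ->
  (forall w z, size w = j -> J n z -> G (gads w z)) -> G x.

Lemma layer_subgroup n j : subgroup (layer n j).
Proof.
split=> [G [G0 _] //|x y hx hy G sG G1 G2].
by apply: (sG.2); [apply: hx|apply: hy].
Qed.

Lemma layerS n j x : J n.+1 x -> layer n j x.
Proof. by move=> Jx G _ G1 _; apply: G1. Qed.

Lemma layer_gads n w z : J n z -> layer n (size w) (gads w z).
Proof. by move=> Jz G _ _; apply. Qed.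

(** By [genS] only factors that are central or generators matter. The former commute with the
    brackets, the latter do so modulo J^(n+1). *)
Lemma layer_ideal n j : ring_ideal (layer n j).
Proof.
have sL := layer_subgroup n j.
split=> // x r hx; split; move: x hx; last first.
  apply: (genS (P := fun r => forall x, layer n j x -> layer n j (r * x))).
  - split=> [x _|r1 r2 h1 h2 x hx]; first by rewrite mul0r; case: sL.
    by rewrite mulrBl; apply: (sL.2); [apply: h1|apply: h2].
  - by move=> x; rewrite mul1r.
  - move=> z r1 cz h x hx; rewrite -mulrA.
    apply: (h x hx (fun y => layer n j (z * y))).
    + exact: subgroup_mull.
    + by move=> y Jy; apply: layerS; apply: comm_power_mull.
    + by move=> w y <- Jy; rewrite -gads_central //; apply: layer_gads; apply: comm_power_mull.
  - move=> i r1 h x hx; rewrite -mulrA.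
    apply: (h x hx (fun y => layer n j (g i * y))).
    + exact: subgroup_mull.
    + by move=> y Jy; apply: layerS; apply: comm_power_mull.
    + move=> w y sw Jy; rewrite -[g i * _](subKr (gads w (g i * y))).
      apply: (sL.2); last by apply: layerS; apply: gads_mull.
      by rewrite -sw; apply: layer_gads; apply: comm_power_mull.
apply: (genS (P := fun r => forall x, layer n j x -> layer n j (x * r))).
- split=> [x _|r1 r2 h1 h2 x hx]; first by rewrite mulr0; case: sL.
  by rewrite mulrBr; apply: (sL.2); [apply: h1|apply: h2].
- by move=> x; rewrite mulr1.
- move=> z r1 cz h x hx; rewrite mulrA; apply: h.
  apply: (hx (fun y => layer n j (y * z))).
  + exact: subgroup_mulr.
  + by move=> y Jy; apply: layerS; apply: comm_power_mulr.
  + by move=> w y <- Jy; rewrite -cz -gads_central //; apply: layer_gads; apply: comm_power_mull.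
- move=> i r1 h x hx; rewrite mulrA; apply: h.
  apply: (hx (fun y => layer n j (y * g i))).
  + exact: subgroup_mulr.
  + by move=> y Jy; apply: layerS; apply: comm_power_mulr.
  + move=> w y sw Jy; rewrite -[_ * g i](subKr (gads w (y * g i))).
    apply: (sL.2); last by apply: layerS; apply: gads_mulr.
    by rewrite -sw; apply: layer_gads; apply: comm_power_mulr.
Qed.

Lemma lieB (x y z : S) : lie x (y - z) = lie x y - lie x z.
Proof. exact: raddfB. Qed.

Lemma lieN (x y : S) : lie x y = - lie y x.
Proof. by rewrite /lie opprB. Qed.

(** The Leibniz rule in [r] reduces this to brackets with generators. *)
Lemma layer_lie n j x r : layer n j x -> layer n j.+1 (lie x r).
Proof.
have [sL iL] := layer_ideal n j.+1.
move: x; apply: (genS (P := fun r => forall x, layer n j x -> layer n j.+1 (lie x r))).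
- split=> [x _|r1 r2 h1 h2 x hx]; first by rewrite raddf0; case: sL.
  by rewrite raddfB; apply: (sL.2); [apply: h1|apply: h2].
- by move=> x _; rewrite /lie mulr1 mul1r subrr; case: sL.
- move=> z r1 cz h x hx; rewrite lie_mul {1}/lie -cz subrr mul0r add0r.
  exact: (iL _ _ (h x hx)).2.
move=> i r1 h x hx; rewrite lie_mul; apply: (subgroupD sL); last exact: (iL _ _ (h x hx)).2.
have iLr u v (hu : layer n j.+1 u) : layer n j.+1 (u * v) := (iL u v hu).1.
apply: iLr; rewrite lieN; apply: (subgroupN sL).
apply: (hx (fun y => layer n j.+1 (lie (g i) y))).
- split=> [|u v hu hv]; first by rewrite raddf0; case: sL.
  by rewrite raddfB; apply: (sL.2).
- by move=> y Jy; apply: layerS; apply: comm_power_lie.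
- by move=> w y <- Jy; apply: (@layer_gads n (i :: w)).
Qed.

(** The commutator of ad(g j) and ad(g i) is ad([g j, g i]), which maps J^n into J^(n+1). *)
Lemma comm_power_swap n i j k y : J n y ->
  J n.+1 (lie (g j) (iter k (lie (g i)) y) - iter k (lie (g i)) (lie (g j) y)).
Proof.
move=> Jy; elim: k => [|k IH]; first by rewrite subrr; case: (comm_power_subgroup g n.+1).
rewrite !iterS; set u := iter k _ _ in IH *; set v := iter k _ _ in IH *.
have Ju : J n u by rewrite /u; elim: (k) => //= k' IHk; apply: comm_power_lie.
have -> : lie (g j) (lie (g i) u) - lie (g i) v =
    lie (g i) (lie (g j) u - v) +
      (lie (g j) (g i) * u - u * lie (g j) (g i)).
  have -> : lie (g i) (lie (g j) u - v) = lie (g i) (lie (g j) u) - lie (g i) v.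
    exact: raddfB.
  rewrite [RHS]addrAC; congr (_ - _).
  transitivity (lie (g j) (g i * u - u * g i)); first by [].
  rewrite raddfB /= !lie_mul opprD [X in X + _]addrC.
  by rewrite addrACA.
apply: comm_powerD; first exact: comm_power_lie.
by apply: comm_powerB; [apply: comm_powerSl|apply: comm_powerSr].
Qed.

Lemma gads_collect n a w z : J n z ->
  J n.+1 (gads w z - iter (count_mem a w) (lie (g a)) (gads (filter (predC1 a) w) z)).
Proof.
move=> Jz; elim: w => [|b w IH] /=; first by rewrite subrr; case: (comm_power_subgroup g n.+1).
have [->|ba] := eqVneq b a; first by rewrite /= -lieB; apply: comm_power_lie.
rewrite /= add0n; set k := count_mem a w in IH *; set y := gads (filter _ w) z in IH *.
rewrite -[lie (g b) _](subrK (lie (g b) (iter k (lie (g a)) y))) -addrA.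
apply: comm_powerD; first by rewrite -lieB; apply: comm_power_lie.
by apply: comm_power_swap; apply: comm_power_gads.
Qed.

(** Pigeonhole: one of the [d] generators occurs at least [e] times in the word, and once its
    brackets are collected the Engel condition applies. *)
Lemma layer_top n x : layer n (d * e).+1 x -> J n.+1 x.
Proof.
apply=> [|//|w z sw Jz]; first exact: comm_power_subgroup.
have [a ea] : exists a, (e <= count_mem a w)%N.
  apply/existsP; apply: contraLR (leqnn (d * e).+1); rewrite negb_exists -ltnNge.
  move=> /forallP few; rewrite -{1}sw size_sum_count.
  rewrite ltnS -[d in (d * e)%N]card_ord -sum_nat_const leq_sum // => a _.
  by rewrite ltnW // ltnNge few.
have := gads_collect a w Jz.
by rewrite -(subnK ea) iterD engS iter_lie0 subr0.
Qed.

Lemma ring_gam_comm_power n x : ring_gam (n * (d * e).+1) x -> J n x.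
Proof.
elim: n x => [//|n IH] x.
suff H j y : ring_gam (n * (d * e).+1 + j) y -> layer n j y.
  by rewrite mulSnr => /H /layer_top.
elim: j y => [|j IHj] y; first by rewrite addn0 => /IH Jy; apply: (@layer_gads n [::]).
rewrite addnS => hy; apply: hy; first exact: layer_ideal.
by move=> a r /IHj; apply: layer_lie.
Qed.

End GammaPower.

Theorem engel_ring_gam_eq0 d e : exists N,
  forall (S : pzRingType) (g : 'I_d -> S), engel e S -> center_generated g ->
  forall x, @ring_gam S N x -> x = 0.
Proof.
have [N hN] := comm_power_nilpotent d e.
exists (N * (d * e).+1)%N => S g engS genS x /(ring_gam_comm_power engS genS).
exact: hN.
Qed.

(** * From a semigroup identity to an Engel identity *)

Lemma infinite_uniq_seq (T : eqType) n : infinite_type T ->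
  exists2 s : seq T, uniq s & size s = n.
Proof.
move=> infT; elim: n => [|n [s us sn]]; first by exists [::].
by have [x xs] := infT s; exists (x :: s); rewrite /= ?xs ?sn.
Qed.

(** * Polynomials evaluated at scalars *)

Section ScalarPoly.
Variables (K : idomainType) (S : algType K).
Hypotheses (infK : infinite_type K)
  (tfS : forall (a : K) (x : S), a *: x = 0 -> a = 0 \/ x = 0).
Implicit Types (p q : {poly S}) (a b : K).

Lemma comm_poly_scalar p a : comm_poly p a%:A.
Proof. by rewrite /comm_poly mulr_algl mulr_algr. Qed.

Lemma hornerM_scalar p q a : (p * q).[a%:A] = p.[a%:A] * q.[a%:A].
Proof. exact/hornerM_comm/comm_poly_scalar. Qed.

(** Root counting: after splitting off X - a, torsion-freeness cancels the nonzero scalar b - a at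
    every other root b. *)
Lemma poly_scalar_roots (rs : seq K) p : uniq rs -> (size p <= size rs)%N ->
  {in rs, forall a, p.[a%:A] = 0} -> p = 0.
Proof.
elim: rs p => [|a rs IH] p /=; first by move=> _; rewrite leqn0 size_poly_eq0 => /eqP.
case/andP=> a_rs urs szp rootp.
have /factor_theorem[q pq] : root p a%:A by apply/rootP/rootp/mem_head.
have [q0|q0] := eqVneq q 0; first by rewrite pq q0 mul0r.
have q0' : q = 0; last by rewrite q0' eqxx in q0.
apply: IH => // [|b brs].
  by move: szp; rewrite pq size_Mmonic ?monicXsubC // size_XsubC addn2.
have := rootp b; rewrite inE brs orbT pq hornerM_scalar hornerXsubC => /(_ isT).
rewrite -scalerBl mulr_algr => /tfS[/eqP|//]; rewrite subr_eq0 => /eqP ba.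
by rewrite ba (negbTE a_rs) in brs.
Qed.

Lemma poly_scalar_eq p q : (forall a, p.[a%:A] = q.[a%:A]) -> p = q.
Proof.
move=> epq; have [rs urs srs] := infinite_uniq_seq (size (p - q)) infK.
apply/eqP; rewrite -subr_eq0; apply/eqP/(poly_scalar_roots urs); first by rewrite srs.
by move=> a _; rewrite hornerD hornerN epq subrr.
Qed.

End ScalarPoly.

Section LinearPart.
Variables (R : pzRingType) (c : nat).

(* The part of degree one in [x] of the word [u] evaluated at
   [(1 + x) * Y] for the letter [c] and at [Y] for the other letters. *)
Fixpoint linear_part (x Y : R) (u : seq nat) : R :=
  if u is v :: u' then
    (v == c)%:R * (x * Y ^+ (size u').+1) + Y * linear_part x Y u'
  else 0.

End LinearPart.

Section LinearPartPoly.
Variables (K : idomainType) (S : algType K) (c : nat).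

(** The polynomial variable is the parameter s in (1 + s x) Y. *)
Definition letter_poly (x Y : S) (v : nat) : {poly S} :=
  (1 + (v == c)%:R *: (x%:P * 'X)) * Y%:P.

Lemma wordval_letter_poly0 x Y u : (wordval (letter_poly x Y) u)`_0 = Y ^+ size u.
Proof.
elim: u => [|v u IH]; first by rewrite /wordval big_nil coef1.
rewrite /wordval big_cons -/(wordval _ u) coef0M IH exprS; congr (_ * _).
by rewrite /letter_poly coefMC coefD coef1 coefZ coefMX mulr0 addr0 mul1r.
Qed.

Lemma wordval_letter_poly1 x Y u :
  (wordval (letter_poly x Y) u)`_1 = linear_part c x Y u.
Proof.
elim: u => [|v u IH]; first by rewrite /wordval big_nil coef1.
rewrite /wordval big_cons -/(wordval _ u) coefM big_ord_recl big_ord1 /= subn0 IH.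
rewrite wordval_letter_poly0 /letter_poly !coefMC !coefD !coef1 !coefZ !coefMX /= !coefC.
by rewrite mulr0 addr0 mul1r add0r addrC -!mulrA exprS.
Qed.

End LinearPartPoly.

Section HomogeneousAction.
Variables (K : idomainType) (S : algType K).
Implicit Types (p q : {poly K}).
Local Notation scal a := ((a%:A)%:P : {poly S}).

Fact scal_central (a : K) (z : {poly S}) : scal a * z = z * scal a.
Proof. by apply/polyP => i; rewrite coefCM coefMC mulr_algl mulr_algr. Qed.

Variables (x : S) (Y : {poly S}).

(* [p(L, R)] applied to [x], where [p] is homogenized in degree [n] and
   [L], [R] are the left and right multiplications by [Y]. *)
Definition hom_act n p : {poly S} :=
  \sum_(i < n.+1) scal p`_i * (Y ^+ i * x%:P * Y ^+ (n - i)).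

Lemma hom_actD n p q : hom_act n (p + q) = hom_act n p + hom_act n q.
Proof.
rewrite -big_split; apply: eq_bigr => i _ /=.
by rewrite coefD scalerDl polyCD mulrDl.
Qed.

Lemma hom_actN n p : hom_act n (- p) = - hom_act n p.
Proof.
by rewrite -sumrN; apply: eq_bigr => i _; rewrite coefN scaleNr polyCN mulNr.
Qed.

Lemma hom_actX n p : hom_act n.+1 ('X * p) = Y * hom_act n p.
Proof.
rewrite /hom_act big_ord_recl coefXM scale0r mul0r add0r mulr_sumr.
apply: eq_bigr => i _; rewrite lift0 coefXM /= subSS exprS !mulrA.
by rewrite -scal_central.
Qed.

Lemma hom_actS n p : (size p <= n.+1)%N -> hom_act n.+1 p = hom_act n p * Y.
Proof.
move=> szp; rewrite /hom_act big_ord_recr /= (nth_default _ szp) scale0r mul0r addr0.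
rewrite mulr_suml; apply: eq_bigr => i _.
by rewrite subSn ?exprSr ?mulrA // -ltnS.
Qed.

(** Multiplication by X - 1 corresponds to L - R, which is ad(Y). By the size bound, homogenizing
    [p] one degree higher only appends a factor [Y] on the right. *)
Lemma hom_actXsub1 n p : (size p <= n.+1)%N ->
  hom_act n.+1 (('X - 1) * p) = lie Y (hom_act n p).
Proof. by move=> szp; rewrite mulrBl mul1r hom_actD hom_actN hom_actX hom_actS. Qed.

Lemma hom_actXsub1_exp n m p : (size p <= n.+1)%N ->
  hom_act (m + n) (('X - 1) ^+ m * p) = iter m (lie Y) (hom_act n p).
Proof.
move=> szp; elim: m => [|m IH]; first by rewrite mul1r.
rewrite exprS -mulrA hom_actXsub1 ?IH //.
have [->|p0] := eqVneq p 0; first by rewrite mulr0 size_poly0.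
rewrite size_monicM // ?monic_exp ?monicXsubC //.
by rewrite size_exp_XsubC /= -addnS leq_add2l.
Qed.

Variable c : nat.

(** The sum of X^i over the positions i of [c]; such a position contributes Y^i x Y^(|u|-i) to the
    linear part. *)
Fixpoint positions (u : seq nat) : {poly K} :=
  if u is v :: u' then ((v == c)%:R)%:P + 'X * positions u' else 0.

Lemma coef_positions u i :
  (positions u)`_i = ((i < size u)%N && (nth 0%N u i == c))%:R.
Proof.
elim: u i => [|v u IH] i /=; first by rewrite coef0.
by rewrite coefD coefC coefXM; case: i => [|i] /=; rewrite ?addr0 // add0r IH ltnS.
Qed.

Lemma size_positions u : (size (positions u) <= size u)%N.
Proof. by apply/leq_sizeP => j /leq_gtF uj; rewrite coef_positions uj. Qed.

Lemma hom_act_positions u :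
  hom_act (size u) (positions u) = linear_part c x%:P Y u.
Proof.
elim: u => [|v u IH] /=.
  by rewrite /hom_act big_ord1 coef0 scale0r mul0r.
rewrite hom_actD hom_actX IH; congr (_ + _).
rewrite /hom_act big_ord_recl big1 => [|i _]; last first.
  by rewrite coefC lift0 scale0r mul0r.
rewrite addr0 coefC /= expr0 mul1r subn0; congr (_ * _).
by case: (v == c); rewrite ?scale1r ?scale0r.
Qed.

End HomogeneousAction.

Section Identity.
Variables (K : idomainType) (S : algType K).
Hypotheses (infK : infinite_type K)
  (tfS : forall (a : K) (x : S), a *: x = 0 -> a = 0 \/ x = 0).

(** In each term of the expansion one of the two powers of [y] has exponent at least n. *)
Lemma iter_lie_nilpotent (R : pzRingType) n (y x : R) : y ^+ n = 0 ->
  iter (2 * n) (lie y) x = 0.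
Proof.
move=> yn; have y0 k : (n <= k)%N -> y ^+ k = 0.
  by move=> /subnK <-; rewrite exprD yn mulr0.
rewrite iter_lie big1 // => l _; have [ln|nl] := leqP l n.
  by rewrite [y ^+ (_ - _)]y0 ?mul0r ?mulr0 ?mul0rn //; lia.
by rewrite [y ^+ l]y0 ?mulr0 ?mul0rn // ltnW.
Qed.

(** [I] stands for the image of the algebra in its unital hull. *)
Lemma identity_engel (I : S -> Prop) (u w : seq nat) :
  (forall s t, I s -> I t -> I (s + t + s * t)) ->
  (forall (a : K) s, I s -> I (a *: s)) ->
  u != w ->
  (forall s : nat -> S, (forall v, I (s v)) ->
     wordval (fun v => 1 + s v) u = wordval (fun v => 1 + s v) w) ->
  forall x y, I x -> I y -> iter (2 * maxn (size u) (size w)) (lie y) x = 0.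
Proof.
move=> Icirc Iscale uw idS x y Ix Iy.
have eqW c (t : K) : wordval (letter_poly c x (1 + t *: y)) u =
                     wordval (letter_poly c x (1 + t *: y)) w.
  apply: (poly_scalar_eq infK tfS) => a.
  (* Chosen so that 1 + s c = (1 + a x)(1 + t y). *)
  pose s v := if v == c then a *: x + t *: y + (a *: x) * (t *: y) else t *: y.
  have E z : (wordval (letter_poly c x (1 + t *: y)) z).[a%:A] = wordval (fun v => 1 + s v) z.
    elim: z => [|v z IH]; first by rewrite /wordval !big_nil hornerC.
    rewrite /wordval !big_cons hornerM_scalar IH; congr (_ * _).
    rewrite /letter_poly hornerM_scalar hornerC hornerD hornerZ hornerM_scalar.
    rewrite !hornerC hornerX /s; case: (v == c) => /=.
      rewrite mulr1n mul1r mulr_algr mulrDl !mulrDr !mul1r !mulr1 -!addrA.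
      by congr (_ + _); rewrite addrCA.
    by rewrite mulr0n mul0r addr0 mul1r.
  rewrite !E; apply: idS => v; rewrite /s; case: ifP => _; last exact: Iscale.
  by apply: Icirc; apply: Iscale.
(* From here on t is the polynomial variable. *)
pose Yp : {poly S} := 1 + y%:P * 'X.
have YpE t : Yp.[t%:A] = 1 + t *: y.
  by rewrite /Yp hornerD hornerC hornerM_scalar hornerC hornerX mulr_algr.
have hornerX_Yp t n : (Yp ^+ n).[t%:A] = (1 + t *: y) ^+ n.
  elim: n => [|n IH]; first by rewrite hornerC.
  by rewrite !exprS hornerM_scalar IH YpE.
have eqYp : Yp ^+ size u = Yp ^+ size w.
  apply: (poly_scalar_eq infK tfS) => t; rewrite !hornerX_Yp.
  by rewrite -!(wordval_letter_poly0 0 x) eqW.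
have topYp n : (size (Yp ^+ n) <= n.+1)%N /\ (Yp ^+ n)`_n = y ^+ n.
  have E i k : (Yp ^+ k.+1)`_i.+1 = (Yp ^+ k)`_i.+1 + (Yp ^+ k)`_i * y.
    by rewrite exprSr mulrDr mulr1 coefD mulrA coefMX coefMC.
  elim: n => [|n [szn topn]]; first by rewrite size_poly1 coef1.
  split; last by rewrite E (nth_default _ szn) add0r topn exprSr.
  apply/leq_sizeP => -[//|j] nj; rewrite E !nth_default ?mul0r ?addr0 //.
    exact: leq_trans szn nj.
  exact: leq_trans szn (ltnW nj).
have [usw|] := eqVneq (size u) (size w); last first.
  wlog : u w {uw idS eqW} eqYp / (size u < size w)%N.
    move=> H; rewrite neq_ltn => /orP[lt|lt].
      by apply: (H u w) => //; rewrite neq_ltn lt.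
    by rewrite maxnC; apply: (H w u) => //; rewrite neq_ltn lt.
  move=> lt _; rewrite (maxn_idPr (ltnW lt)); apply: iter_lie_nilpotent.
  rewrite -(topYp (size w)).2 -eqYp nth_default //.
  exact: leq_trans (topYp _).1 lt.
(* At a place where the words differ, the letter of [u] has different position polynomials in [u]
   and [w]. *)
have [c neP] : exists c, positions K c u - positions K c w != 0.
  apply: contrapT => /forallNP eqpos; case/eqP: uw.
  apply: (@eq_from_nth _ 0%N) => // i iu.
  have /negP := eqpos (nth 0%N u i); rewrite negbK subr_eq0.
  move=> /eqP/(congr1 (fun p : {poly K} => p`_i)); rewrite !coef_positions -usw iu eqxx /=.
  by case: eqP => // _ /eqP; rewrite oner_eq0.
set P := positions K c u - positions K c w in neP *.
have actP : hom_act x Yp (size u) P = 0.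
  rewrite hom_actD hom_actN {2}usw !hom_act_positions.
  have L z t : (linear_part c x%:P Yp z).[t%:A] = linear_part c x (1 + t *: y) z.
    elim: z => [|v z IH] /=; first by rewrite hornerC.
    rewrite hornerD !hornerM_scalar IH hornerX_Yp YpE hornerC; congr (_ * _ + _).
    by case: (v == c); rewrite hornerC.
  apply/eqP; rewrite subr_eq0; apply/eqP/(poly_scalar_eq infK tfS) => t.
  by rewrite !L -!wordval_letter_poly1 eqW.
have [m [Q]] := multiplicity_XsubC P 1; rewrite neP /= => rootQ eP.
have szP : (size P <= size u)%N.
  rewrite (leq_trans (size_polyD _ _)) // size_polyN geq_max size_positions usw.
  exact: size_positions.
have Q0 : Q != 0 by apply: contraNneq rootQ => ->; rewrite root0.
have szQ : (size Q + m <= size u)%N.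
  move: szP; rewrite eP size_Mmonic ?monic_exp ?monicXsubC //.
  by rewrite size_exp_XsubC addnS.
have mu : (m <= size u)%N by apply: leq_trans szQ; apply: leq_addl.
have szQ' : (size Q <= (size u - m).+1)%N by rewrite leqW // leq_subRL // addnC.
have := hom_actXsub1_exp x Yp (n := size u - m) m (p := Q).
rewrite subnKC // mulrC -eP actP => H.
have {}H : 0 = iter m (lie Yp) (hom_act x Yp (size u - m) Q).
  by apply: H.
(* As ad(1 + t y) = t ad(y), a factor t^m splits off and can be cancelled. *)
have lieYp z : lie Yp z = lie y%:P z * 'X.
  rewrite /lie /Yp mulrDl mulrDr mul1r mulr1 opprD addrACA subrr add0r.
  by rewrite mulrBl -!mulrA -(commr_polyX z).
have iterYp z : iter m (lie Yp) z = iter m (lie y%:P) z * 'X^m.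
  elim: (m) => [|k IH]; first by rewrite mulr1.
  rewrite !iterS IH lieYp lie_mul exprSr mulrA; congr (_ * _).
  have -> : lie y%:P 'X^k = 0 by rewrite /lie commr_polyXn subrr.
  by rewrite mulr0 addr0.
have iter0 : iter m (lie y%:P) (hom_act x Yp (size u - m) Q) = 0.
  apply/polyP => i; have := coefMXn m (iter m (lie y%:P) (hom_act x Yp (size u - m) Q)) (i + m).
  by rewrite -iterYp -H !coef0 addnK ltnNge leq_addl /= => <-.
have coef0_iter z : (iter m (lie y%:P) z)`_0 = iter m (lie y) z`_0.
  elim: (m) => [//|k IH]; rewrite !iterS -IH.
  by rewrite {1}/lie coefB !coef0M coefC.
(* At t = 0 every [Yp] becomes 1, so the coefficients of [Q] add up. *)
have act0 : (hom_act x Yp (size u - m) Q)`_0 = Q.[1] *: x.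
  rewrite coef_sum (horner_coef_wide _ szQ').
  rewrite scaler_suml; apply: eq_bigr => i _.
  have Yp0 k : (Yp ^+ k)`_0 = 1.
    elim: k => [|k IH]; first by rewrite coef1.
    by rewrite exprS coef0M IH coefD coef1 coefMX addr0 mulr1.
  by rewrite !coef0M !Yp0 !coefC /= mul1r mulr1 expr1n mulr1 mulr_algl.
have iterZ k a : iter k (lie y) (a *: x) = a *: iter k (lie y) x.
  elim: k => [//|k IH]; rewrite !iterS IH.
  by rewrite /lie -scalerAl -scalerAr scalerBr.
have := coef0_iter (hom_act x Yp (size u - m) Q).
rewrite iter0 coef0 act0 iterZ => /esym/tfS[Q1|xm].
  by move: rootQ; rewrite /root Q1 eqxx.
have mle : (m <= 2 * maxn (size u) (size w))%N.
  by rewrite (leq_trans mu) // (leq_trans (leq_maxl _ (size w))) // leq_pmull.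
by rewrite -(subnK mle) iterD xm iter_lie0.
Qed.

End Identity.

(** * The unital hull *)

(** The proof [algR] is an argument of the type so that the ring structure can be attached to it. *)
Definition hull (K : comNzRingType) (R : lmodType K) (mul : R -> R -> R)
  (algR : is_assoc_alg mul) := (K^o * R)%type.

Section Hull.
Variables (K : comNzRingType) (R : lmodType K) (mul : R -> R -> R).
Hypothesis algR : is_assoc_alg mul.
Local Notation S := (hull algR).

HB.instance Definition _ := GRing.Lmodule.copy S (K^o * R)%type.

Let mulA : associative mul. Proof. by case: algR. Qed.
Let mulDl x y z : mul (x + y) z = mul x z + mul y z. Proof. by case: algR. Qed.
Let mulDr x y z : mul x (y + z) = mul x y + mul x z. Proof. by case: algR. Qed.
Let mulZl a x y : mul (a *: x) y = a *: mul x y. Proof. by case: algR. Qed.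
Let mulZr a x y : mul x (a *: y) = a *: mul x y. Proof. by case: algR. Qed.
Let mul0 x : mul 0 x = 0. Proof. by have := mulZl 0 0 x; rewrite !scale0r. Qed.
Let mulx0 x : mul x 0 = 0. Proof. by have := mulZr 0 x 0; rewrite !scale0r. Qed.

Definition hull_one : S := (1, 0).
Definition hull_mul (x y : S) : S :=
  (x.1 * y.1, x.1 *: y.2 + y.1 *: x.2 + mul x.2 y.2).

Fact hull_mulA : associative hull_mul.
Proof.
move=> [a x] [b y] [c z]; rewrite /hull_mul /=; congr (_, _); first exact: mulrA.
rewrite !scalerDr !mulDr !mulDl !mulZr !mulZl !scalerA mulA !addrA.
by rewrite [c * a]mulrC [c * b]mulrC [LHS](ACl (1*2*4*6*3*5*7)).
Qed.

Fact hull_mul1 : left_id hull_one hull_mul.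
Proof.
by move=> [a x]; rewrite /hull_mul /= mul1r scale1r scaler0 addr0 mul0 addr0.
Qed.

Fact hull_mulr1 : right_id hull_one hull_mul.
Proof.
by move=> [a x]; rewrite /hull_mul /= mulr1 scale1r scaler0 add0r mulx0 addr0.
Qed.

Fact hull_mulDl : left_distributive hull_mul +%R.
Proof.
move=> [a x] [b y] [c z]; congr (_, _); first exact: mulrDl.
by rewrite /= scalerDl scalerDr mulDl !addrA [LHS](ACl (1*3*5*2*4*6)).
Qed.

Fact hull_mulDr : right_distributive hull_mul +%R.
Proof.
move=> [a x] [b y] [c z]; congr (_, _); first exact: mulrDr.
by rewrite /= scalerDl scalerDr mulDr !addrA [LHS](ACl (1*3*5*2*4*6)).
Qed.

Fact hull_one_neq0 : hull_one != 0.
Proof. by rewrite xpair_eqE negb_and oner_eq0. Qed.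

HB.instance Definition _ := GRing.Zmodule_isNzRing.Build S
  hull_mulA hull_mul1 hull_mulr1 hull_mulDl hull_mulDr hull_one_neq0.

Fact hull_scalerAl (a : K) (x y : S) : a *: (x * y) = a *: x * y.
Proof.
congr (_, _); first exact: mulrA.
by rewrite /= !scalerDr !scalerA mulZl [y.1 * a]mulrC.
Qed.
HB.instance Definition _ := GRing.Lmodule_isLalgebra.Build K S hull_scalerAl.

Fact hull_scalerAr (a : K) (x y : S) : a *: (x * y) = x * (a *: y).
Proof.
congr (_, _); first exact: mulrCA.
by rewrite /= !scalerDr !scalerA mulZr [x.1 * a]mulrC.
Qed.
HB.instance Definition _ := GRing.Lalgebra_isAlgebra.Build K S hull_scalerAr.

Definition in_hull (x : R) : S := (0, x).

Lemma in_hullD x y : in_hull (x + y) = in_hull x + in_hull y.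
Proof. by congr (_, _); rewrite addr0. Qed.

Lemma in_hullB x y : in_hull (x - y) = in_hull x - in_hull y.
Proof. by congr (_, _); rewrite subr0. Qed.

Lemma in_hullZ a x : in_hull (a *: x) = a *: in_hull x.
Proof. by congr (_, _); rewrite scaler0. Qed.

Lemma in_hullM x y : in_hull (mul x y) = in_hull x * in_hull y.
Proof. by congr (_, _); rewrite /= ?mulr0 // !scale0r !add0r. Qed.

Lemma hull_split (x : S) : x = x.1%:A + in_hull x.2.
Proof.
case: x => a x; congr (_, _); rewrite /= ?addr0 ?scaler0 ?add0r //.
by rewrite /GRing.scale /= mulr1.
Qed.

Lemma hull_lie (x y : S) : lie y x = lie (in_hull y.2) (in_hull x.2).
Proof.
have lieAr (a : K) (z : S) : lie z a%:A = 0 by rewrite /lie mulr_algl mulr_algr subrr.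
have lieD (a b c : S) : lie a (b + c) = lie a b + lie a c by exact: raddfD.
rewrite {1}(hull_split x) lieD lieAr add0r lieN {1}(hull_split y) lieD lieAr.
by rewrite add0r -lieN.
Qed.

(** The map x -> 1 + x turns the circle operation into multiplication. *)
Lemma word_eval_hull (s : nat -> R) (w : seq nat) : w != [::] ->
  1 + in_hull (word_eval (circ mul) s w) = wordval (fun v => 1 + in_hull (s v)) w.
Proof.
case: w => // v w _; rewrite /word_eval /=.
rewrite {1}/wordval big_cons -/(wordval _ w).
elim: w (s v) => [|v' w IH] x0 /=; first by rewrite /wordval big_nil mulr1.
rewrite IH /wordval big_cons mulrA; congr (_ * _).
by rewrite mulrDl !mulrDr !mul1r mulr1 /circ !in_hullD in_hullM !addrA [LHS](ACl (1*3*2*4)).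
Qed.

(** The r whose left multiplication preserves [P] form a subalgebra; scalars are central in the
    hull. *)
Lemma hull_center_generated d (g : 'I_d -> R) :
  generates mul g -> center_generated (fun i => in_hull (g i)).
Proof.
move=> genR P [P0 PB] P1 Pz Pg.
have sP : subgroup P by [].
have PZ (a : K) (x : S) : P x -> P (a *: x).
  by move=> Px; rewrite -mulr_algl; apply: Pz => // y; rewrite mulr_algl mulr_algr.
suff H r : forall s, P s -> P (in_hull r * s).
  move=> x; rewrite (hull_split x); apply: subgroupD => //; first exact: PZ.
  by rewrite -[in_hull _]mulr1; apply: H.
apply: (genR (fun r => forall s, P s -> P (in_hull r * s))); last by move=> i; apply: Pg.
split.
- by move=> s _; rewrite mul0r.
- by move=> x y hx hy s Ps; rewrite in_hullD mulrDl; apply: subgroupD => //; [apply: hx|apply: hy].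
- by move=> a x hx s Ps; rewrite in_hullZ -scalerAl; apply/PZ/hx.
- by move=> x y hx hy s Ps; rewrite in_hullM -mulrA; apply/hx/hy.
Qed.

(** Ideals of the hull are pulled back to ideals of the algebra. *)
Lemma gam_hull m x : gam mul m x -> ring_gam m (in_hull x).
Proof.
elim: m x => [//|m IH] x hx I [sI iI] hI.
apply: (hx (fun x => I (in_hull x))).
  split.
  - by case: sI.
  - by move=> u v Iu Iv; rewrite in_hullD; apply: subgroupD.
  - by move=> a u Iu; rewrite in_hullZ -mulr_algl; case: (iI _ (a%:A) Iu).
  - by move=> u r Iu; rewrite !in_hullM; apply: iI.
move=> c [a [r [ga ->]]]; rewrite /comm in_hullB !in_hullM.
by apply: hI; apply: IH.
Qed.

End Hull.

Lemma hull_engel (K : idomainType) (R : lmodType K) (mul : R -> R -> R) (n : nat)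
    (algR : is_assoc_alg mul) :
  infinite_type K -> torsion_free R -> has_sg_identity (circ mul) n ->
  engel (2 * n) (hull algR).
Proof.
move=> infK tfR [u [w [u0 w0 uw sz idR]]].
have n0 : (0 < 2 * n)%N by rewrite -sz muln_gt0 /= leq_max !lt0n !size_eq0 u0.
have tfS (a : K) (x : hull algR) : a *: x = 0 -> a = 0 \/ x = 0.
  case: x => b x [/eqP]; rewrite mulf_eq0 => /orP[/eqP->|/eqP->]; first by left.
  by case/tfR => ->; [left|right].
have H x y : iter (2 * n) (lie (in_hull algR y)) (in_hull algR x) = 0.
  rewrite -sz; apply: (identity_engel infK tfS (I := fun z => exists r, z = in_hull algR r)) => //.
  - by move=> _ _ [r ->] [s ->]; exists (circ mul r s); rewrite !in_hullD in_hullM.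
  - by move=> a _ [r ->]; exists (a *: r); rewrite in_hullZ.
  - move=> s /choice[t st].
    have -> : s = fun v => in_hull algR (t v) by apply: funext.
    by rewrite -!word_eval_hull // idR.
  - by exists x.
  - by exists y.
(* At least one bracket is present, and it removes the scalar parts. *)
move=> y x; rewrite -(prednK n0) iterSr hull_lie -[RHS](H x.2 y.2).
rewrite -[in RHS](prednK n0) iterSr.
by apply: eq_iter => z; rewrite [LHS]hull_lie [RHS]hull_lie.
Qed.

Theorem theorem1p5 :
  exists f : nat -> nat -> nat,
  forall (K : idomainType), infinite_type K ->
  forall (R : lmodType K) (mul : R -> R -> R) (d n : nat),
    is_assoc_alg mul ->
    torsion_free R ->
    (exists g : 'I_d -> R, generates mul g) ->
    has_sg_identity (circ mul) n ->
    upper_Lie_nilpotent mul (f d n).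
Proof.
(* The successor compensates for [gamma i] being [gam i.-1]; 2 n is the Engel exponent of the
   hull. *)
exists (fun d n => (sval (cid (engel_ring_gam_eq0 d (2 * n)))).+1).
move=> K infK R mul d n algR tfR [g genR] idR x.
rewrite /gamma /=; case: cid => N /= hN /(gam_hull algR).
move/(hN _ _ (@hull_engel _ _ _ _ algR infK tfR idR) (@hull_center_generated _ _ _ algR _ _ genR)).
by case.
Qed.
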